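(* Let $I\subset\mathbb{R}$ be a bounded interval of positive length, and let $p\geq 1$ and $\max(2,p)\leq r<\infty$. Then for every real-valued function $\varphi\in\mathrm{BMO}(I)$ with $\langle\varphi\rangle_I=0$, $$\|\varphi\|_{L^r(I)}\leq \Big(\frac{\Gamma(r+1)}{\Gamma(p+1)}\Big)^{\frac1r}\|\varphi\|_{L^p(I)}^{\frac pr}\,\|\varphi\|_{\mathrm{BMO}(I)}^{1-\frac pr}.$$ Moreover, the inequality is sharp: for each such pair $(p,r)$ the constant $\big(\Gamma(r+1)/\Gamma(p+1)\big)^{1/r}$ cannot be replaced by a smaller one.
   Context: For a set $E$ of positive measure, $\langle\psi\rangle_E=\frac1{|E|}\int_E\psi$. For real-valued $\varphi\in L^1(I)$ set $$\|\varphi\|_{\mathrm{BMO}(I)}^2=\sup_{J}\ \big\langle|\varphi-\langle\varphi\rangle_J|^2\big\rangle_J,$$ the supremum being over all subintervals $J$ of $I$; $\varphi\in\mathrm{BMO}(I)$ means that this quantity is finite. $\Gamma$ is Euler's Gamma function. When $p=r$, the factor with exponent $1-\frac pr=0$ is understood as $1$. *)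

(* Defs.v *)
From mathcomp Require Import all_boot all_order all_algebra.
From mathcomp Require Import all_classical all_reals all_analysis.

Set Implicit Arguments.
Unset Strict Implicit.
Unset Printing Implicit Defensive.

Import Order.TTheory GRing.Theory Num.Theory.
Import numFieldNormedType.Exports.

Local Open Scope classical_set_scope.
Local Open Scope ring_scope.

Definition Gamma (R : realType) (s : R) : R :=
  (\int[lebesgue_measure]_(x in `]0%R, +oo[) (x `^ (s - 1) * expR (- x)))%R.

(* Meaningful for E of positive finite measure. The value is an extended real,
   since psi >= 0 may have infinite integral. *)
Definition average (R : realType) (E : set R) (psi : R -> R) : \bar R :=
  ((fine (lebesgue_measure E))^-1%:E *
   \int[lebesgue_measure]_(x in E) (psi x)%:E)%E.

(* Degenerate intervals are excluded: averages over them are not defined. *)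
Definition subintervals (R : realType) (I : set R) : set (set R) :=
  [set J | [/\ is_interval J, J `<=` I & (0 < lebesgue_measure J)%E]].

(* When phi is integrable on I, its averages are finite, so fine is harmless. *)
Definition bmo_norm (R : realType) (I : set R) (phi : R -> R) : \bar R :=
  sqrte (ereal_sup
    [set average J (fun x => `|phi x - fine (average J phi)| ^+ 2)
    | J in subintervals I]).

Definition bmo (R : realType) (I : set R) : set (R -> R) :=
  [set phi | lebesgue_measure.-integrable I (EFin \o phi) /\
             (bmo_norm I phi < +oo)%E].

(* phi is extended by point = 0 outside I, as Lnorm integrates over the whole line. *)
Definition Lp_norm (R : realType) (I : set R) (p : R) (phi : R -> R) : \bar R :=
  'N[lebesgue_measure]_(p%:E)[EFin \o (phi \_ I)].

(* Main.v *)
Require Import Defs.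
From HB Require Import structures.
From mathcomp Require Import all_boot all_order all_algebra.
From mathcomp Require Import all_classical all_reals all_analysis.
From mathcomp Require Import measurable_realfun lra.

Set Implicit Arguments.
Unset Strict Implicit.
Unset Printing Implicit Defensive.

Import Order.TTheory GRing.Theory Num.Theory.
Import numFieldNormedType.Exports.

Local Open Scope classical_set_scope.
Local Open Scope ring_scope.

(* Normalize the BMO norm to 1. If psi has mean at most 1 on I, the rising sun
   lemma for the primitive of psi - 1 splits off intervals on which psi has mean
   1, and psi <= 1 elsewhere. With psi = phi - t or - phi - t, t >= 0, the variance
   bound on these intervals yields that H(t), the integral of
   max(0, |phi| - t) ^ 2, is at most twice the integral of max(0, |phi| - t),
   that is H <= - H': so expR t * H(t) is nonincreasing. For s > 2, |phi| ^ s is a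
   mixture over t of the kernels max(0, |phi| - t) ^ 2 with weight t ^ (s - 3), and
   for 1 < s < 2 of the complementary kernels. Hence the moments of phi compare
   with those of the exponential distribution, for which expR t * H(t) is constant
   and the moment of order s is Gamma(s + 1).

   Equality holds for a function with a positive logarithmic singularity at one
   end of I and a negative one at the other end, of BMO norm at most 1: both of its
   tails are exactly exponential. *)

(** * The rising sun lemma *)

Section last_point.
Context {R : realType}.
Implicit Types (F : R -> R) (a b v x y : R).

(** On an interval where psi has mean 1, variance at most 1 bounds the integral of psi ^ 2 by twice
    the length, that is, by twice the integral of psi; this is the origin of the factor 2 in the
    tail inequality. The inequality controls the second order tail H rather than the distribution
    function, so the comparisons are anchored at the moment of order 2, which is H(0): smaller and
    larger moments are compared with it separately, and two orders above 2 with each other by a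
    single crossing argument. At p = 1 the complementary mixture diverges, and the tail inequality
    at t = 0 replaces it. H is not differentiated: H <= - H' is used in the form (1 + e) H(t + e) <=
    H(t). The mixture constants and the values of Gamma are not computed either: the same identities
    are applied to the exponential distribution, and the unknown constants cancel in the comparison.
    For sharpness a norm at most 1 is enough, since the norm carries the exponent 1 - p / r >= 0. *)

Lemma last_ge F a b v : a <= b -> continuous F -> v <= F a ->
  exists c, [/\ a <= c <= b, v <= F c & forall y, c < y <= b -> F y < v].
Proof.
move=> ab cF Fa.
pose A := `[a, b]%classic `&` (F @^-1` [set z | v <= z]).
have cA : compact A.
  apply: compact_closedI; first exact: segment_compact.
  by apply: preimage_closed => //; exact: closed_ge.
have A0 : A !=set0 by exists a; split => //=; rewrite in_itv/= lexx.
(* The last point is where the identity attains its maximum on the compact set [A]. *)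
have cid : {within A, continuous (@idfun R)}.
  by apply: continuous_subspaceT => x; exact: cvg_id.
have [c /set_mem[/= + Fc] cmax] := compact_EVT_max A0 cA cid.
rewrite in_itv/= => /andP[ac cb]; exists c; split; rewrite ?ac//.
move=> y /andP[cy yb]; rewrite ltNge; apply/negP => Fy.
have /cmax /= : y \in A.
  by rewrite inE; split => //=; rewrite in_itv/= yb (le_trans ac (ltW cy)).
by rewrite leNgt cy.
Qed.

Lemma last_eq F a b v : a <= b -> continuous F -> v <= F a -> F b <= v ->
  exists c, [/\ a <= c <= b, F c = v & forall y, c < y <= b -> F y < v].
Proof.
move=> ab cF Fa Fb; have [c [/andP[ac cb] Fc cmax]] := last_ge ab cF Fa.
exists c; split; rewrite ?ac ?cb//.
(* A crossing of the level [v] after [c] would contradict that [c] is last, so [d] is [c]. *)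
have [d + Fd] : exists2 d, d \in `[c, b] & F d = v.
  apply: IVT => //; first exact: continuous_subspaceT.
  by rewrite ge_min Fb orbT le_max Fc.
rewrite in_itv/= => /andP[]; rewrite le_eqVlt => /predU1P[-> //|cd db].
by have := cmax d; rewrite cd db Fd ltxx => /(_ isT).
Qed.

Lemma first_ge F a b v : a <= b -> continuous F -> v <= F b ->
  exists c, [/\ a <= c <= b, v <= F c & forall y, a <= y < c -> F y < v].
Proof.
move=> ab cF Fb.
have cG : continuous (F \o -%R).
  by move=> x; apply: continuous_comp; [exact: opp_continuous|exact: cF].
have [c [/andP[bc ca] Fc H]] : exists c, [/\ - b <= c <= - a,
    v <= (F \o -%R) c & forall y, c < y <= - a -> (F \o -%R) y < v].
  by apply: last_ge => //=; rewrite ?lerN2 ?opprK.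
exists (- c); split => //; first by rewrite lerNr ca lerNl.
move=> y /andP[ay yc]; rewrite -(opprK y); apply: H.
by rewrite ltrNr yc lerN2.
Qed.

(* ]c, d[ is the component of x in the open set of the points to the right of
   which F takes a larger value. *)
Lemma rising_sun_component F a b x : continuous F -> a <= x <= b ->
  (forall y, a <= y <= b -> F y <= F a) ->
  (exists2 y, x <= y <= b & F x < F y) ->
  exists c d, [/\ a <= c < x, x < d <= b, F c = F d,
    forall y, c < y < d -> F y < F d & forall y, c <= y <= b -> F y <= F d].
Proof.
move=> cF /andP[ax xb] Fmax [y0 /andP[xy0 y0b] Fy0].
have [m + Hm] := EVT_max xb (continuous_subspaceT cF : {within `[x, b], continuous F}).
rewrite in_itv/= => /andP[xm mb].
have Fxm : F x < F m by apply: lt_le_trans Fy0 _; apply: Hm; rewrite in_itv/= xy0.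
have [d [/andP[xd dm] Fd dfst]] := first_ge xm cF (lexx (F m)).
have {}Fd : F d = F m.
  by apply/eqP; rewrite eq_le Fd Hm// in_itv/= xd (le_trans dm).
have mx : F m <= F a by apply: Fmax; rewrite mb (le_trans ax).
have [c [/andP[ac cx] Fc clast]] := last_eq ax cF mx (ltW Fxm).
exists c, d; split.
- by rewrite ac lt_neqAle cx andbT; apply: contraTneq Fxm => <-; rewrite Fc ltxx.
- rewrite (le_trans dm mb) andbT lt_neqAle xd andbT.
  by apply: contraTneq Fxm => ->; rewrite Fd ltxx.
- by rewrite Fc Fd.
- move=> y /andP[cy yd]; rewrite Fd.
  have [yx|xy] := leP y x; first by apply: clast; rewrite cy.
  by apply: dfst; rewrite (ltW xy).
- move=> y /andP[cy yb]; rewrite Fd.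
  move: cy; rewrite le_eqVlt => /predU1P[<-|cy]; first by rewrite Fc.
  have [yx|xy] := leP y x; first by apply/ltW/clast; rewrite cy.
  by apply: Hm; rewrite in_itv/= (ltW xy).
Qed.

End last_point.

Section rising_sun.
Context {R : realType}.
Implicit Types (F : R -> R) (a b c d x y : R).

Let P F b c d := [/\ c < d <= b, F c = F d,
  forall y, c < y < d -> F y < F d & forall y, c <= y <= b -> F y <= F d].

(** If c < c', then c' lies inside []c, d[], so F c' < F d; but d lies in [[c', b]], so F d <= F d'
    = F c'. With equal left ends, the smaller right end d is interior to the other interval, so F d
    < F d', against the last clause of [P], which reaches up to [b]. *)
Let P_eq F b c d c' d' z : P F b c d -> P F b c' d' ->
  c < z < d -> c' < z < d' -> c = c' /\ d = d'.
Proof.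
wlog: c d c' d' / c <= c'.
  move=> H; have [|/ltW] := leP c c'; first exact: H.
  by move=> cc p p' h h'; have [] := H _ _ _ _ cc p' p h' h.
move=> cc p p' /andP[cz zd] /andP[c'z zd'].
have ecc : c = c'.
  move: cc; rewrite le_eqVlt => /predU1P[//|cc].
  case: p => /andP[cd db] _ /(_ c' _) H _.
  case: p' => _ Fc' _ /(_ d _) H'.
  move: H; rewrite cc (lt_trans c'z zd) => /(_ isT).
  by rewrite ltNge Fc' H'// db (ltW (lt_trans c'z zd)).
split=> //; move: p' c'z; rewrite -{}ecc => p' c'z.
have [dd|dd|//] := ltgtP d d'.
- case: p => _ _ _ /(_ d' _) H; case: p' => /andP[cd' d'b] _ /(_ d _) H' _.
  by move: H'; rewrite (lt_trans cz zd) dd ltNge H ?d'b ?(ltW cd')// => /(_ isT).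
- case: p' => _ _ _ /(_ d _) H; case: p => /andP[cd db] _ /(_ d' _) H' _.
  by move: H'; rewrite (lt_trans cz zd') dd ltNge H ?db ?(ltW cd)// => /(_ isT).
Qed.

(** Each component contains a rational, so [pickle] enumerates them all, with repetitions.
    Components that meet coincide, so [seqDU] only replaces repetitions by the empty set, which
    still has the required form []a, a[]. That [F a] is the maximum keeps the left end of every
    component inside [[a, b]]. *)
Let rising_sun_max F a b : a <= b -> continuous F ->
  (forall y, a <= y <= b -> F y <= F a) ->
  exists A : nat -> set R,
  [/\ forall n, exists c d, [/\ a <= c, c <= d, d <= b, F c = F d & A n = `]c, d[%classic],
      trivIset setT A &
      forall x, a < x < b -> (forall n, ~ A n x) ->
        forall y, x <= y <= b -> F y <= F x].
Proof.
move=> ab cF Fmax.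
pose C (q : rat) : set R := [set x | exists c d,
  [/\ a <= c, P F b c d, c < ratr q < d & c < x < d]].
have CE q c d : a <= c -> P F b c d -> c < ratr q < d -> C q = `]c, d[%classic.
  move=> ac p cqd; rewrite eqEsubset; split => x /=.
    by move=> [c' [d' [ac' p' cqd']]]; rewrite in_itv/=; have [-> ->] := P_eq p p' cqd cqd'.
  by rewrite in_itv/= => cxd; exists c, d.
pose B n := if @unpickle rat n is Some q then C q else set0.
have BE n : B n = set0 \/ exists c d, [/\ a <= c, P F b c d & B n = `]c, d[%classic].
  rewrite /B; case: unpickle => [q|]; last by left.
  have [->|/set0P[x [c [d [ac p cqd _]]]]] := eqVneq (C q) set0; first by left.
  by right; exists c, d; split=> //; exact: CE.
exists (seqDU B); split; last 2 first.
- exact: trivIset_seqDU.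
- move=> x /andP[ax xb] nx y /andP[xy yb]; rewrite leNgt; apply/negP => Fxy.
  have axb : a <= x <= b by rewrite !ltW.
  have [|c [d [/andP[ac cx] /andP[xd db] Fcd H1 H2]]] :=
    rising_sun_component cF axb Fmax.
    by exists y => //; rewrite xy.
  have [q] := rat_in_itvoo (lt_trans cx xd); rewrite in_itv/= => cqd.
  have p : P F b c d by split => //; rewrite db (lt_trans cx xd).
  have Bq : B (pickle q) = `]c, d[%classic by rewrite /B pickleK; exact: CE.
  move: (pickle q) Bq => k Bk.
  have : (\bigcup_n B n) x.
    by exists k => //; rewrite Bk /= in_itv/= cx.
  by rewrite seqDU_bigcup_eq => -[n _]; exact: nx.
- have H0 : exists c d, [/\ a <= c, c <= d, d <= b, F c = F d & set0 = `]c, d[%classic].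
    by exists a, a; split; rewrite // set_itvoo0.
  move=> n; rewrite /seqDU -bigcup_mkord.
  have [B0|[c [d [ac p Bcd]]]] := BE n; first by rewrite B0 set0D.
  have [[m mn [z [Bmz Bnz]]]|nm] := pselect (exists2 m, (m < n)%N & B m `&` B n !=set0).
    have [B0|[c' [d' [ac' p' Bcd']]]] := BE m; first by rewrite B0 in Bmz.
    rewrite (_ : _ `\` _ = set0)//; apply/seteqP; split => // u [Bnu]; apply.
    exists m => //; move: Bmz Bnz Bnu; rewrite Bcd Bcd' /= !in_itv/= => zm zn.
    by have [-> ->] := P_eq p p' zn zm.
  exists c, d; split => //; try by case: p => /andP[/ltW ? ?].
  rewrite -Bcd; apply/seteqP; split => [u []//|u Bnu]; split => //.
  by move=> [m /= mn Bmu]; apply: nm; exists m => //; exists u.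
Qed.

(** With e the last point of level [F a], the interval []a, e[] has equal end values and is one more
    member of the family; from e on, [F e] is the maximum and the previous case applies. *)
Lemma rising_sun F a b : a <= b -> continuous F -> F b <= F a ->
  exists A : nat -> set R,
  [/\ forall n, exists c d, [/\ a <= c, c <= d, d <= b, F c = F d & A n = `]c, d[%classic],
      trivIset setT A &
      forall x, a < x < b -> (forall n, ~ A n x) ->
        forall y, x <= y <= b -> F y <= F x].
Proof.
move=> ab cF Fba.
have [e [/andP[ae eb] Fe elast]] := last_eq ab cF (lexx (F a)) Fba.
have Fmax y : e <= y <= b -> F y <= F e.
  move=> /andP[]; rewrite le_eqVlt => /predU1P[-> //|ey yb].
  by rewrite Fe ltW// elast// ey.
have [A [HA tA Ax]] := rising_sun_max eb cF Fmax.
exists (fun n => if n is n'.+1 then A n' else `]a, e[%classic); split.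
- case=> [|n]; first by exists a, e.
  by have [c [d [ec cd db Fcd ->]]] := HA n; exists c, d; split => //; exact: le_trans ec.
- have Ae n z : A n z -> e < z.
    have [c [d [ec _ _ _ ->]]] := HA n; rewrite /= in_itv/= => /andP[cz _].
    exact: le_lt_trans cz.
  move=> [|m] [|n] _ _ //= [z [/= zm zn]].
  + by move: zm (Ae _ _ zn); rewrite in_itv/= => /andP[_ /lt_trans h] /h; rewrite ltxx.
  + by move: zn (Ae _ _ zm); rewrite in_itv/= => /andP[_ /lt_trans h] /h; rewrite ltxx.
  + by congr S; apply: tA => //; exists z.
- move=> x /andP[ax xb] nx y xyb.
  have [xe|ex|xe] := ltgtP x e.
  + by have := nx 0%N; rewrite /= in_itv/= ax xe.
  + by apply: Ax => //; [rewrite ex|move=> n; exact: (nx n.+1)].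
  + by rewrite xe; apply: Fmax; rewrite -xe.
Qed.

End rising_sun.

(** * Primitives of integrable functions on an open interval *)

Section primitive.
Context {R : realType}.
Notation mu := (@lebesgue_measure R).

Lemma derive1_le0_right (F : R -> R) (x b : R) : x < b -> derivable F x 1 ->
  (forall y, x <= y <= b -> F y <= F x) -> derive1 F x <= 0.
Proof.
move=> xb dF Fx; rewrite derive1E.
have /cvg_ex[l Hl] := dF.
have -> : 'D_1 F x = l by exact/cvg_lim.
have Hr : h^-1 *: (F (h *: 1 + x) - F x) @[h --> 0^'+] --> l.
  exact: cvg_dnbhs_at_right.
rewrite -(cvg_lim _ Hr)//; apply: limr_le; first by apply/cvg_ex; exists l.
near=> h; rewrite /GRing.scale/= mulr1 pmulr_rle0 ?invr_gt0 ?subr_le0; last first.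
  by near: h; exact: nbhs_right_gt.
apply: Fx; rewrite lerDr addrC.
have h0 : 0 < h by near: h; exact: nbhs_right_gt.
rewrite (ltW h0)/= -lerBrDl; near: h; apply: nbhs_right_le; by rewrite subr_gt0.
Unshelve. all: end_near. Qed.

Variables (g : R -> R) (a b : R).
Hypothesis ig : mu.-integrable setT (EFin \o (g \_ `]a, b[)).

(** Integrating from a - 1 makes every x >= a an interior point of [[a - 1, x + 1]], where the
    integral depends continuously on its upper end. To the left of a the function is 0, so it is
    continuous on the whole line, as [rising_sun] asks. *)
Let F (x : R) := \int[mu]_(t in `[a - 1, x]) (g \_ `]a, b[) t.

Let iG (A : set R) : measurable A -> mu.-integrable A (EFin \o (g \_ `]a, b[)).
Proof. by move=> mA; exact: integrableS ig. Qed.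

Let cF : continuous F.
Proof.
move=> x; have [xa|ax] := ltP x a.
  have F0 y : y < a -> F y = 0.
    move=> ya; rewrite /F /Rintegral (_ : integral _ _ _ = 0%E)//.
    apply: integral0_eq => z /=; rewrite in_itv/= => /andP[_ zy].
    rewrite patchE memNset//= in_itv/= => /andP[az _].
    by have := lt_trans az (le_lt_trans zy ya); rewrite ltxx.
  rewrite /continuous_at F0//; apply: cvg_near_cst.
  by near=> y; apply: F0; near: y; exact: lt_nbhsl.
have a1x1 : a - 1 <= x + 1 by lra.
have /continuous_within_itvP[] := parameterized_integral_continuous a1x1 (iG (measurable_itv _)).
  lra.
move=> H _ _; apply: H; rewrite in_itv/=; lra.
Unshelve. all: end_near. Qed.

Let FB c d : a <= c -> c <= d -> d <= b ->
  (\int[mu]_(x in `]c, d[) (g x)%:E = (F d - F c)%:E)%E.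
Proof.
move=> ac cd db.
rewrite /F Rintegral_itvB ?bnd_simp//; [|exact: iG|lra].
rewrite /Rintegral fineK; last by apply: integrable_fin_num => //; exact: iG.
have mgp : measurable_fun `]c, d[ (g \_ `]a, b[).
  by apply/measurable_EFinP; exact: measurable_int (iG (measurable_itv _)).
rewrite (integral_itv_bndoo false false); last exact/measurable_EFinP.
apply: eq_integral => x; rewrite inE/= in_itv/= => /andP[cx xd].
by rewrite patchE mem_set//= in_itv/= (le_lt_trans ac cx) (lt_le_trans xd db).
Qed.

Lemma primitive_exists : exists F : R -> R, [/\ continuous F,
  (forall c d, a <= c -> c <= d -> d <= b ->
     (\int[mu]_(x in `]c, d[) (g x)%:E = (F d - F c)%:E)%E) &
  {ae mu, forall x, a < x < b -> derivable F x 1 /\ derive1 F x = g x}].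
Proof.
exists F; split; [exact: cF|exact: FB|].
have := @FTC1 _ (g \_ `]a, b[) (BLeft (a - 1)).
case=> [y||N [mN N0 HN]]; first exact: iG.
- by apply: open_integrable_locally => //; exact: openT.
- exists N; split=> // x /= nx; apply: HN => /= Fx; apply: nx => /andP[ax xb].
  have [] := Fx; first by rewrite lte_fin; lra.
  by move=> dF ->; split => //; rewrite patchE mem_set//= in_itv/= ax.
Qed.

End primitive.

(** * Exponential decay of the tails *)

Section stopping.
Context {R : realType}.
Notation mu := (@lebesgue_measure R).
Implicit Types (psi : R -> R) (a b c d : R).
Local Open Scope ereal_scope.

(** To be used with [m] the length of [J], where psi has mean 1. Truncation at 0 decreases the
    integral of the square and increases that of psi, so the bound survives on both sides. *)
Lemma pos_part_stopped psi (J : set R) (m : R) : measurable J ->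
  mu.-integrable J (EFin \o psi) ->
  \int[mu]_(x in J) (psi x)%:E = m%:E ->
  \int[mu]_(x in J) ((psi x) ^+ 2)%:E <= (2 * m)%:E ->
  \int[mu]_(x in J) ((Num.max 0 (psi x)) ^+ 2)%:E <=
  \int[mu]_(x in J) (2 * Num.max 0 (psi x))%:E.
Proof.
move=> mJ ipsi Em H.
have mpsi : measurable_fun J psi by apply/measurable_EFinP; exact: measurable_int ipsi.
have mmax : measurable_fun J (fun x => Num.max 0 (psi x))%R by exact: measurable_maxr.
apply: (@le_trans _ _ (\int[mu]_(x in J) ((psi x) ^+ 2)%:E)).
  apply: ge0_le_integral => //.
  - by move=> x _; rewrite lee_fin sqr_ge0.
  - by apply/measurable_EFinP; exact: measurable_funX.
  - by apply/measurable_EFinP; exact: measurable_funX.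
  - by move=> x _; rewrite lee_fin; case: (ltP 0%R (psi x)) => h; nra.
apply: (le_trans H); rewrite EFinM -Em.
have -> : 2%:E * \int[mu]_(x in J) (psi x)%:E = \int[mu]_(x in J) (2 * psi x)%:E.
  by under [RHS]eq_integral do rewrite EFinM; rewrite integralZl.
have i2 : mu.-integrable J (EFin \o (fun x => 2 * psi x)%R).
  by rewrite (_ : _ \o _ = fun x => 2%:E * (EFin \o psi) x)//; exact: integrableZl.
apply: le_integral => //; last first.
  by move=> x _; rewrite lee_fin ler_pM2l// le_max lexx orbT.
apply: (@le_integrable _ _ _ mu _ mJ _ _ _ _ i2).
  by apply/measurable_EFinP; exact: measurable_funM.
by move=> x _; rewrite lee_fin !normrM ler_pM2l ?normr_gt0//; case: (ltP 0%R (psi x)) => h; rewrite ?normr0// normr_ge0.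
Qed.

(* Outside the stopping intervals, on which psi has mean 1, the rising sun lemma
   for the primitive of psi - 1 gives psi <= 1 a.e., and then the inequality
   holds pointwise. *)
Lemma pos_part_sqr_le psi a b : (a < b)%R ->
  mu.-integrable `]a, b[ (EFin \o psi) ->
  (forall c d, (a <= c)%R -> (c < d)%R -> (d <= b)%R ->
     \int[mu]_(x in `]c, d[) (psi x)%:E = (d - c)%:E ->
     \int[mu]_(x in `]c, d[) ((psi x) ^+ 2)%:E <= (2 * (d - c))%:E) ->
  \int[mu]_(x in `]a, b[) (psi x)%:E <= (b - a)%:E ->
  \int[mu]_(x in `]a, b[) ((Num.max 0 (psi x)) ^+ 2)%:E <=
  \int[mu]_(x in `]a, b[) (2 * Num.max 0 (psi x))%:E.
Proof.
move=> ab ipsi Hstop Hmean.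
set I := `]a, b[%classic.
have mI : measurable I by exact: measurable_itv.
have lI (c d : R) : (c <= d)%R -> mu `]c, d[%classic = (d - c)%:E.
  by rewrite lebesgue_measure_itv/= lte_fin le_eqVlt => /predU1P[->|->//]; rewrite ltxx subrr.
have i1 (J : set R) (c d : R) : J = `]c, d[%classic -> (c <= d)%R -> mu.-integrable J (EFin \o cst 1%R).
  move=> -> cd; apply/integrableP; split; first exact/measurable_EFinP.
  by under eq_integral do rewrite /= normr1; rewrite integral_cst//= mul1e lI// ltry.
pose g (x : R) := (psi x - 1)%R.
have ig : mu.-integrable I (EFin \o g).
  rewrite (_ : EFin \o g = (EFin \o psi) \- (EFin \o cst 1%R))//.
  by apply: integrableB => //; apply: (i1 _ a b) => //; exact: ltW.
have [F [cF FB dF]] : exists F : R -> R, [/\ continuous F,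
  (forall c d, (a <= c)%R -> (c <= d)%R -> (d <= b)%R ->
     \int[mu]_(x in `]c, d[) (g x)%:E = (F d - F c)%:E) &
  {ae mu, forall x, (a < x < b)%R -> derivable F x 1 /\ derive1 F x = g x}].
  apply: primitive_exists.
  rewrite -restrict_EFin.
  by apply/(@integrable_mkcond _ _ R mu `]a, b[%classic (EFin \o g) (measurable_itv _)).
have subI c d : (a <= c)%R -> (d <= b)%R -> `]c, d[%classic `<=` I.
  move=> ac db x; rewrite /I/= !in_itv/= => /andP[cx xd].
  by rewrite (le_lt_trans ac cx) (lt_le_trans xd db).
have psiB c d : (a <= c)%R -> (c <= d)%R -> (d <= b)%R ->
     \int[mu]_(x in `]c, d[) (psi x)%:E = (F d - F c + (d - c))%:E.
  move=> ac cd db; rewrite EFinD -FB// -(lI c d)// -[in X in _ + X](mul1e (mu _)) -integral_cst//.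
  rewrite -integralD_EFin//.
  - by apply: eq_integral => x _; rewrite -EFinD /g subrK.
  - by apply: integrableS ig => //; exact: subI.
  - by apply: (i1 _ c d).
have Fba : (F b <= F a)%R.
  by move: Hmean; rewrite psiB ?(ltW ab)// lee_fin; lra.
have [A [HA tA Aout]] := rising_sun (ltW ab) cF Fba.
pose D := \bigcup_n A n.
have mA n : measurable (A n) by have [c [d [_ _ _ _ ->]]] := HA n; exact: measurable_itv.
have mD : measurable D by exact: bigcup_measurable.
have DI : D `<=` I by move=> x [n _]; have [c [d [? _ ? _ ->]]] := HA n; exact: subI.
have mpsi : measurable_fun I psi by apply/measurable_EFinP; exact: measurable_int ipsi.
have mmax : measurable_fun I (fun x => Num.max 0 (psi x))%R by exact: measurable_maxr.
have m1 : measurable_fun I (fun x => ((Num.max 0 (psi x)) ^+ 2)%:E).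
  by apply/measurable_EFinP; exact: measurable_funX.
have m2 : measurable_fun I (fun x => (2 * (Num.max 0 (psi x)))%:E).
  by apply/measurable_EFinP; exact: measurable_funM.
have p1 x : 0 <= ((Num.max 0 (psi x)) ^+ 2)%:E by rewrite lee_fin sqr_ge0.
have p2 x : 0 <= (2 * (Num.max 0 (psi x)))%:E by rewrite lee_fin mulr_ge0// le_max lexx.
have HD : \int[mu]_(x in D) ((Num.max 0 (psi x)) ^+ 2)%:E <=
    \int[mu]_(x in D) (2 * Num.max 0 (psi x))%:E.
  rewrite ge0_integral_bigcup//; last exact: measurable_funS m1.
  rewrite ge0_integral_bigcup//; last exact: measurable_funS m2.
  apply: lee_nneseries => [n _ _|n _]; first exact: integral_ge0.
  have [c [d [ac cd db Fcd ->]]] := HA n.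
  have E1 : \int[mu]_(x in `]c, d[) (psi x)%:E = (d - c)%:E.
    by rewrite psiB// Fcd subrr add0r.
  apply: (pos_part_stopped _ _ E1) => //.
    by apply: integrableS ipsi => //; exact: subI.
  move: cd; rewrite le_eqVlt => /predU1P[cd|cd]; last exact: Hstop.
  by rewrite cd set_itvoo0 integral_set0 subrr mulr0.
have HC : \int[mu]_(x in I `\` D) ((Num.max 0 (psi x)) ^+ 2)%:E <=
    \int[mu]_(x in I `\` D) (2 * Num.max 0 (psi x))%:E.
  apply: ae_ge0_le_integral => //.
  - exact: measurableD.
  - by apply: measurable_funS m1 => // x [].
  - by apply: measurable_funS m2 => // x [].
  - case: dF => N [mN N0 HN]; exists N; split => // x /= nx; apply: HN => /= dFx.
    apply: nx => -[+ nDx]; rewrite /I/= in_itv/= => axb.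
    have [dx dFE] := dFx axb.
    have := @derive1_le0_right _ F x b; rewrite dFE => /(_ _ dx) H.
    have {}H : (g x <= 0)%R.
      apply: H; first by case/andP: axb.
      by apply: Aout => // n An; apply: nDx; exists n.
    move: H; rewrite /g subr_le0 lee_fin => psi1.
    by case: (ltP 0%R (psi x)) => h; nra.
have -> : I = D `|` (I `\` D) by rewrite setDUK.
rewrite !ge0_integral_setU//; first exact: leeD.
all: try exact: measurableD.
all: try (rewrite setDUK//).
all: by apply/disj_setPS; rewrite setDIK.
Qed.

End stopping.

Section tails.
Context {R : realType}.
Notation mu := (@lebesgue_measure R).
Implicit Types (phi v : R -> R) (a b c d m s t : R).
Local Open Scope ereal_scope.

Lemma integrable_cst_itvoo (c d k : R) : mu.-integrable `]c, d[ (EFin \o cst k).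
Proof.
apply/integrableP; split; first exact/measurable_EFinP.
under eq_integral do rewrite /=.
rewrite integral_cst//= lebesgue_measure_itv/=.
by case: ifPn => _; rewrite ?mule0 ?ltry// -EFinM ltry.
Qed.

Lemma integral_cst_itvoo (c d k : R) : (c <= d)%R ->
  \int[mu]_(x in `]c, d[) k%:E = (k * (d - c))%:E.
Proof.
move=> cd; rewrite integral_cst//= lebesgue_measure_itv/= lte_fin.
case: ltP => [_|dc]; first by rewrite EFinM.
by rewrite (_ : d = c) ?subrr ?mulr0 ?mule0//; apply/eqP; rewrite eq_le cd dc.
Qed.

Lemma integral_affine_itvoo phi (c d k l m : R) : (c <= d)%R ->
  mu.-integrable `]c, d[ (EFin \o phi) ->
  \int[mu]_(x in `]c, d[) (phi x)%:E = m%:E ->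
  mu.-integrable `]c, d[ (EFin \o (fun x => k * phi x + l)%R) /\
  \int[mu]_(x in `]c, d[) (k * phi x + l)%:E = (k * m + l * (d - c))%:E.
Proof.
move=> cd iphi Em.
have ik : mu.-integrable `]c, d[ (EFin \o (fun x => k * phi x)%R).
  by rewrite (_ : _ \o _ = fun x => k%:E * (EFin \o phi) x)//; exact: integrableZl.
split.
  rewrite (_ : _ \o _ = (EFin \o (fun x => k * phi x)%R) \+ (EFin \o cst l))//.
  by apply: integrableD => //; exact: integrable_cst_itvoo.
under eq_integral do rewrite EFinD.
rewrite integralD_EFin//; last exact: integrable_cst_itvoo.
rewrite integral_cst_itvoo// EFinD; congr (_ + _).
by under eq_integral do rewrite /= EFinM; rewrite integralZl// Em.
Qed.

Section bmo1.
Variables (phi : R -> R) (a b : R).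
Hypotheses (ab : (a < b)%R) (iphi : mu.-integrable `]a, b[ (EFin \o phi)).
Hypothesis phi0 : \int[mu]_(x in `]a, b[) (phi x)%:E = 0.
(** BMO norm at most 1. The mean m enters through the equation that it satisfies, so that neither a
    quotient nor [fine] appears. *)
Hypothesis var1 : forall c d m, (a <= c)%R -> (c < d)%R -> (d <= b)%R ->
  \int[mu]_(x in `]c, d[) (phi x)%:E = (m * (d - c))%:E ->
  \int[mu]_(x in `]c, d[) ((phi x - m) ^+ 2)%:E <= (d - c)%:E.

Let mphi : measurable_fun `]a, b[ phi.
Proof. by apply/measurable_EFinP; exact: measurable_int iphi. Qed.

(** The sign s = 1 or -1 is encoded by s * s = 1, so both halves of the tail have one proof. The
    mean of s * phi - t over the whole interval is - t <= 1, which starts the stopping argument. *)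
Let half_tail s t : (s * s = 1)%R -> (0 <= t)%R ->
  \int[mu]_(x in `]a, b[) ((Num.max 0 (s * phi x - t)) ^+ 2)%:E <=
  \int[mu]_(x in `]a, b[) (2 * Num.max 0 (s * phi x - t))%:E.
Proof.
move=> s1 t0.
have [ipsi Epsi] := @integral_affine_itvoo phi a b s (- t) 0 (ltW ab) iphi phi0.
apply: (pos_part_sqr_le ab ipsi) => /=; last first.
  have : (0 <= t * (b - a))%R by rewrite mulr_ge0// subr_ge0 ltW.
  move=> h; rewrite Epsi lee_fin mulr0 add0r mulNr.
  by rewrite (@le_trans _ _ 0%R) ?oppr_le0// subr_ge0 ltW.
move=> c d ac cd db Ecd.
have sub : `]c, d[%classic `<=` `]a, b[%classic.
  by apply: subset_itvSoo; rewrite bnd_simp.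
have iphi' : mu.-integrable `]c, d[ (EFin \o phi) by exact: integrableS iphi.
have ipsi' : mu.-integrable `]c, d[ (EFin \o (fun x => s * phi x - t)%R) by exact: integrableS ipsi.
have Ephi : \int[mu]_(x in `]c, d[) (phi x)%:E = (s * (1 + t) * (d - c))%:E.
  have [_] := @integral_affine_itvoo _ c d s (s * t) (d - c)%R (ltW cd) ipsi' Ecd.
  move=> E; transitivity ((s * (d - c) + s * t * (d - c))%:E); last by congr EFin; lra.
  rewrite -E; apply: eq_integral => x _; congr EFin.
  by rewrite mulrBr mulrA s1; lra.
have /= V := var1 ac cd db Ephi.
have mphi' : measurable_fun `]c, d[ phi by exact: measurable_funS mphi.
have i2 : mu.-integrable `]c, d[ (EFin \o (fun x => (phi x - s * (1 + t)) ^+ 2)%R).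
  apply/integrableP; split.
    by apply/measurable_EFinP/measurable_funX; exact: measurable_funB.
  under eq_integral => x _ do rewrite /= ger0_norm ?sqr_ge0//.
  by apply: le_lt_trans V _; rewrite ltry.
have [ipsi2 Epsi2] := @integral_affine_itvoo _ c d 2 (- 1) (d - c)%R (ltW cd) ipsi' Ecd.
(* If psi = s * phi - t has mean 1, then phi has mean s * (1 + t), and psi ^ 2 = (psi - 1) ^ 2 + (2
   psi - 1), where psi - 1 = s * (phi - s * (1 + t)). *)
have -> : \int[mu]_(x in `]c, d[) ((s * phi x - t) ^+ 2)%:E =
   \int[mu]_(x in `]c, d[) (((phi x - s * (1 + t)) ^+ 2)%:E + (2 * (s * phi x - t) - 1)%:E).
  apply: eq_integral => x _; rewrite -EFinD; congr EFin.
  set y := phi x.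
  have -> : ((y - s * (1 + t)) ^+ 2 = y ^+ 2 - 2 * s * y * (1 + t) + s * s * (1 + t) ^+ 2)%R by lra.
  have -> : ((s * y - t) ^+ 2 = s * s * y ^+ 2 - 2 * s * y * t + t ^+ 2)%R by lra.
  by rewrite s1; lra.
rewrite integralD_EFin//= Epsi2.
apply: (@le_trans _ _ ((d - c)%:E + (2 * (d - c) + -1 * (d - c))%:E)).
  exact: leeD.
by rewrite -EFinD lee_fin; lra.
Qed.

(** Since t >= 0, at most one of phi - t and - phi - t is positive at a point, so both integrands
    are sums over the two signs. *)
Lemma tail_sqr_le t : (0 <= t)%R ->
  \int[mu]_(x in `]a, b[) ((Num.max 0 (`|phi x| - t)) ^+ 2)%:E <=
  \int[mu]_(x in `]a, b[) (2 * Num.max 0 (`|phi x| - t))%:E.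
Proof.
move=> t0.
have mm (s : R) : measurable_fun `]a, b[ (fun x => Num.max 0 (s * phi x - t))%R.
  by apply: measurable_maxr => //; apply: measurable_funB => //; exact: measurable_funM.
have E (x : R) : (Num.max 0 (`|phi x| - t) ^+ 2 =
    Num.max 0 (1 * phi x - t) ^+ 2 + Num.max 0 ((-1) * phi x - t) ^+ 2)%R /\
   (2 * Num.max 0 (`|phi x| - t) =
    2 * Num.max 0 (1 * phi x - t) + 2 * Num.max 0 ((-1) * phi x - t))%R.
  rewrite mul1r mulN1r.
  have [p0|p0] := leP 0%R (phi x).
    have -> : Num.max 0%R (- phi x - t)%R = 0%R by apply/max_idPl; lra.
    by rewrite ger0_norm// expr0n/= mulr0 !addr0.
  have -> : Num.max 0%R (phi x - t)%R = 0%R by apply/max_idPl; lra.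
  by rewrite ltr0_norm// expr0n/= mulr0 !add0r.
under eq_integral => x _ do rewrite (E x).1 EFinD.
under [leRHS]eq_integral => x _ do rewrite (E x).2 EFinD.
rewrite !ge0_integralD//; try by (move=> x _; rewrite lee_fin ?sqr_ge0// mulr_ge0// le_max lexx).
- by apply: leeD; apply: half_tail => //; rewrite ?mulr1// mulrNN mulr1.
- by apply/measurable_EFinP; apply: measurable_funM => //; exact: mm.
- by apply/measurable_EFinP; apply: measurable_funM => //; exact: mm.
- by apply/measurable_EFinP/measurable_funX; exact: mm.
- by apply/measurable_EFinP/measurable_funX; exact: mm.
Qed.

End bmo1.

(** A discrete Gronwall argument: a step of length e gains a factor 1 + e, and n + 1 steps of length
    (s - t) / (n + 1) give the exponential in the limit. *)
Lemma tail_decay (D : set R) v : measurable D -> measurable_fun D v ->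
  \int[mu]_(x in D) ((Num.max 0 (v x)) ^+ 2)%:E < +oo ->
  (forall t, (0 <= t)%R ->
  \int[mu]_(x in D) ((Num.max 0 (v x - t)) ^+ 2)%:E <=
  \int[mu]_(x in D) (2 * Num.max 0 (v x - t))%:E) ->
  forall t s, (0 <= t <= s)%R ->
   \int[mu]_(x in D) ((Num.max 0 (v x - s)) ^+ 2)%:E <=
   (expR (t - s))%:E * \int[mu]_(x in D) ((Num.max 0 (v x - t)) ^+ 2)%:E.
Proof.
move=> mD mv fin0 H.
have mm t : measurable_fun D (fun x => Num.max 0 (v x - t))%R.
  by apply: measurable_maxr => //; exact: measurable_funB.
have m2 t : measurable_fun D (fun x => ((Num.max 0 (v x - t)) ^+ 2)%:E).
  by apply/measurable_EFinP; exact: measurable_funX.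
have p2 t x : 0 <= ((Num.max 0 (v x - t)) ^+ 2)%:E by rewrite lee_fin sqr_ge0.
pose H2 (t : R) : \bar R := \int[mu]_(x in D) ((Num.max 0 (v x - t)) ^+ 2)%:E.
have H2fin t : (0 <= t)%R -> H2 t \is a fin_num.
  move=> t0; rewrite ge0_fin_numE ?integral_ge0//; apply: le_lt_trans fin0.
  apply: ge0_le_integral => //.
    exact: m2.
    by apply/measurable_EFinP/measurable_funX; exact: measurable_maxr.
  move=> x _; rewrite lee_fin; apply: lerXn2r; rewrite ?nnegrE ?le_max ?lexx//.
  by case: (leP (v x - t)%R 0%R) => h1; case: (leP (v x) 0%R) => h2; lra.
have E t : (0 <= t)%R -> H2 t = (fine (H2 t))%:E by move=> t0; rewrite fineK// H2fin.
have h0 t : (0 <= fine (H2 t))%R by apply: fine_ge0; exact: integral_ge0.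
(* With y = max(0, v - t - e), pointwise y ^ 2 + 2 e y <= max(0, v - t) ^ 2; the hypothesis at t + e
   bounds the integral of 2 y from below. *)
have step (t e : R) : (0 <= t)%R -> (0 <= e)%R -> ((1 + e) * fine (H2 (t + e)) <= fine (H2 t))%R.
  move=> t0 e0; have te0 : (0 <= t + e)%R by lra.
  rewrite mulrDl mul1r -lee_fin EFinD EFinM -!E//.
  apply: (@le_trans _ _ (H2 (t + e)%R + e%:E * \int[mu]_(x in D) (2 * Num.max 0 (v x - (t + e)))%:E)%E).
    by apply: leeD => //; apply: lee_wpmul2l => //; exact: H.
  have m3 : measurable_fun D (fun x => (2 * Num.max 0 (v x - (t + e)))%:E).
    by apply/measurable_EFinP; exact: measurable_funM.
  have p3 x : 0 <= (2 * Num.max 0 (v x - (t + e)))%:E.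
    by rewrite lee_fin mulr_ge0// le_max lexx.
  rewrite -ge0_integralZl_EFin// -ge0_integralD//; last 2 first.
  - by move=> x _; rewrite mule_ge0.
  - exact: measurable_funeM.
  apply: ge0_le_integral => //.
  - by move=> x _; rewrite adde_ge0// mule_ge0.
  - by apply: emeasurable_funD; [exact: m2|exact: measurable_funeM].
  - exact: m2.
  - move=> x _; rewrite -EFinM -EFinD lee_fin.
    case: (leP (v x - t)%R 0%R) => h1; case: (leP (v x - (t + e))%R 0%R) => h2; nra.
  exact: m2.
have iter (t e : R) n : (0 <= t)%R -> (0 <= e)%R ->
    ((1 + e) ^+ n * fine (H2 (t + n%:R * e)) <= fine (H2 t))%R.
  move=> t0 e0; elim: n => [|n IHn]; first by rewrite expr0 mul1r mul0r addr0.
  apply: le_trans IHn; rewrite exprSr -mulrA ler_wpM2l ?exprn_ge0//; first lra.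
  have -> : (t + n.+1%:R * e = t + n%:R * e + e)%R by rewrite -natr1; lra.
  apply: step => //.
  by rewrite addr_ge0// mulr_ge0.
move=> t s /andP[t0 ts].
have s0 := le_trans t0 ts.
change (H2 s <= (expR (t - s))%:E * H2 t).
rewrite (E s s0) (E t t0) -EFinM lee_fin.
pose d := (s - t)%R.
have d0 : (0 <= d)%R by rewrite subr_ge0.
have bound n : (fine (H2 s) <= expR (- (d * (1 + d * harmonic n)^-1)) * fine (H2 t))%R.
  pose e := (d * harmonic n)%R.
  have e0 : (0 <= e)%R by rewrite mulr_ge0// invr_ge0.
  have := iter t e n.+1 t0 e0.
  have -> : (t + n.+1%:R * e = s)%R.
    by rewrite /e /harmonic mulrCA divff ?pnatr_eq0// mulr1 /d; lra.
  move=> it.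
  have e1 : (0 < 1 + e)%R by lra.
  have P : (0 < (1 + e) ^+ n.+1)%R by exact: exprn_gt0.
  rewrite -(ler_pM2l P); apply: (le_trans it).
  rewrite mulrA -[leLHS]mul1r; apply: ler_wpM2r => //.
  have -> : (- (d * (1 + d * harmonic n)^-1) = n.+1%:R * (- (e / (1 + e))))%R.
    by rewrite mulrN /e; congr (- _)%R; rewrite mulrA [(_ * (d * _))%R]mulrCA divff ?pnatr_eq0// mulr1.
  rewrite expRM_natl -exprMn; apply: exprn_ege1.
  (* 1 / (1 + e) <= expR (- e / (1 + e)) converts the power of 1 + e into an exponential on the side
     where an upper bound is wanted; the loss 1 / (1 + e) in the exponent tends to 1. *)
  have := expR_ge1Dx (- (e / (1 + e)))%R.
  have -> : (1 - e / (1 + e) = (1 + e)^-1)%R.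
    by rewrite -[X in (X - _)%R](divff (lt0r_neq0 e1)) -mulrBl addrK mul1r.
  by move=> h; have := ler_wpM2l (ltW e1) h; rewrite divff ?gt_eqF.
have cv : (expR (- (d * (1 + d * harmonic n)^-1)) * fine (H2 t))%R @[n --> \oo] -->
    (expR (- (d * (1 + d * 0)^-1)) * fine (H2 t))%R.
  apply: cvgMl; apply: (@cvg_comp _ _ _ _ expR _ (nbhs (- (d * (1 + d * 0)^-1))%R)); last exact: continuous_expR.
  apply: cvgN; apply: cvgMr; apply: cvgV; first by rewrite mulr0 addr0 oner_neq0.
  apply: cvgD; first exact: cvg_cst.
  apply: cvgMr; exact: cvg_harmonic.
have -> : (t - s = - (d * (1 + d * 0)^-1))%R by rewrite mulr0 addr0 invr1 mulr1 opprB.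
rewrite -(cvg_lim _ cv)//; apply: limr_ge.
  by apply/cvg_ex; eexists; exact: cv.
by apply: nearW => n; exact: bound.
Qed.

End tails.

(** * Powers as mixtures of truncated squares *)

Section substitution.
Context {R : realType}.
Notation mu := (@lebesgue_measure R).
Local Open Scope ereal_scope.

(** Lebesgue measure and c times its image under x |-> c x + d agree on half-open intervals, hence
    everywhere. *)
Lemma ge0_integral_affine (c d : R) (f : R -> \bar R) : (0 < c)%R ->
  measurable_fun setT f -> (forall x, 0 <= f x) ->
  \int[mu]_x f (c * x + d)%R = c^-1%:E * \int[mu]_x f x.
Proof.
move=> c0 mf f0.
pose T : R -> measurableTypeR R := fun x => (c * x + d)%R.
have mT : measurable_fun setT T.
  by apply: measurable_funD => //; exact: measurable_funM.
have c_ge0 := ltW c0.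
pose m1 := measure_function_pushforward__canonical__measure_function_Measure mu mT.
pose m2 := mscale (NngNum c_ge0) m1.
have H A : measurable A -> mu A = m2 A.
  move=> mA; apply: lebesgue_measure_unique => //= _ [[p q]] _ <-.
  rewrite /m2 /mscale/= /m1/= /pushforward.
  have -> : T @^-1` `]p, q] = `]((p - d) / c)%R, ((q - d) / c)%R]%classic.
    apply/seteqP; split=> x /=; rewrite /T !in_itv/= ltr_pdivrMr// ler_pdivlMr// mulrC;
      move=> /andP[? ?]; apply/andP; split; lra.
  rewrite !lebesgue_measure_itv/= !lte_fin ltr_pM2r ?invr_gt0// ltrD2r.
  case: ifPn => _; last by rewrite mule0.
  rewrite -!EFinD -EFinM; congr EFin.
  by rewrite -mulrBl mulrC divfK ?gt_eqF//; lra.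
rewrite [in RHS](eq_measure_integral m2) => [|A mA _]; last exact: H.
rewrite ge0_integral_mscale//= /m1 ge0_integral_pushforward//=.
rewrite preimage_setT muleA -EFinM mulVf ?gt_eqF// mul1e.
by [].
Qed.

End substitution.

Section kernels.
Context {R : realType}.
Notation mu := (@lebesgue_measure R).
Local Open Scope ereal_scope.
Implicit Types (x t s c : R) (k : R -> R -> R).

(** The cut-off lets all integrals run over the whole line, where the affine substitution is
    available, and hides the values of [powR] at t <= 0. *)
Definition theta s t : R := (\1_`]0%R, +oo[%classic t * t `^ s)%R.

Lemma theta_ge0 s t : (0 <= theta s t)%R.
Proof. by rewrite /theta mulr_ge0 ?powR_ge0// indicE. Qed.

Lemma measurable_theta s : measurable_fun setT (theta s).
Proof. exact: measurable_funM. Qed.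

Lemma theta0 s t : (t <= 0)%R -> theta s t = 0%R.
Proof.
move=> t0; rewrite /theta indicE memNset ?mul0r//=.
by rewrite in_itv/= andbT ltNge t0.
Qed.

Lemma thetaE s t : (0 < t)%R -> theta s t = (t `^ s)%R.
Proof.
by move=> t0; rewrite /theta indicE mem_set ?mul1r//= in_itv/= andbT.
Qed.

Lemma thetaM s c t : (0 < c)%R -> theta s (c * t) = (c `^ s * theta s t)%R.
Proof.
move=> c0; have [t0|t0] := ltP 0%R t.
  by rewrite !thetaE ?mulr_gt0// powRM// ltW.
by rewrite !theta0 ?mulr0// pmulr_rle0.
Qed.

Definition homogeneous_kernel (m : nat) k :=
  [/\ measurable_fun setT (fun z : R * R => k z.1 z.2),
      forall c x t, (0 < c)%R -> (0 <= x)%R -> (0 < t)%R ->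
        k (c * x)%R (c * t)%R = (c ^+ m * k x t)%R,
      forall x t, (0 <= x)%R -> (0 < t)%R -> (0 <= k x t)%R &
      forall t, (0 < t)%R -> k 0%R t = 0%R].

(** Substitute t = x u: the weight gives x ^ a, the kernel x ^ m and dt one more power. At x = 0
    both sides vanish because s > 0. *)
Lemma kernel_power m k a s x : homogeneous_kernel m k ->
  (s = a + 1 + m%:R)%R -> (0 < s)%R -> (0 <= x)%R ->
  \int[mu]_t (theta a t * k x t)%:E =
  (x `^ s)%:E * \int[mu]_t (theta a t * k 1%R t)%:E.
Proof.
move=> [mk hk k0 kz] Es s0; rewrite le_eqVlt => /predU1P[<-|x0].
  rewrite powR0 ?gt_eqF// mul0e; apply: integral0_eq => t _; congr EFin.
  have [t0|t0] := ltP 0%R t; first by rewrite kz// mulr0.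
  by rewrite theta0// mul0r.
have mk1 : measurable_fun setT (k 1%R) := measurableT_comp mk (measurable_pair1 _).
have mkx : measurable_fun setT (k x) := measurableT_comp mk (measurable_pair1 _).
have p (y : R) t : (0 <= y)%R -> (0 <= theta a t * k y t)%R.
  move=> y0; have [t0|t0] := ltP 0%R t; first by rewrite mulr_ge0 ?theta_ge0// k0.
  by rewrite theta0// mul0r.
have mt := measurable_theta a.
have E : \int[mu]_t (theta a t * k x t)%:E = x%:E * \int[mu]_t (theta a (x * t) * k x (x * t))%:E.
  have := @ge0_integral_affine R x 0 (fun t => (theta a t * k x t)%:E) x0.
  under eq_integral do rewrite addr0.
  move=> ->.
  - by rewrite muleA -EFinM divff ?gt_eqF// mul1e.
  - by apply/measurable_EFinP; exact: measurable_funM.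
  - by move=> t; rewrite lee_fin p// ltW.
rewrite E.
under eq_integral => t _.
  rewrite (_ : theta a (x * t) * k x (x * t) = x `^ (a + m%:R) * (theta a t * k 1 t))%R; last first.
    have [t0|t0] := ltP 0%R t; last by rewrite !theta0 ?mul0r ?mulr0// pmulr_rle0.
    rewrite thetaM// -{2}(mulr1 x) hk//.
    rewrite powRD ?(gt_eqF x0) ?implybT// powR_mulrn ?(ltW x0)//; lra.
  rewrite EFinM.
  over.
rewrite ge0_integralZl_EFin//.
- have -> : (a + m%:R = s - 1)%R by lra.
  by rewrite muleA -EFinM mulr_powRB1// ltW.
- by move=> t _; rewrite lee_fin p.
- by apply/measurable_EFinP; exact: measurable_funM.
- exact: powR_ge0.
Qed.

(** [kernel_power] at x = v, integrated against w, and Tonelli. The constant stays as a factor on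
    the left, so the identity holds even when it is infinite. *)
Lemma kernel_moment m k a s (w v : R -> R) : homogeneous_kernel m k ->
  (s = a + 1 + m%:R)%R -> (0 < s)%R ->
  measurable_fun setT w -> measurable_fun setT v ->
  (forall x, 0 <= w x)%R -> (forall x, 0 <= v x)%R ->
  \int[mu]_x (w x * v x `^ s)%:E * \int[mu]_t (theta a t * k 1%R t)%:E =
  \int[mu]_t ((theta a t)%:E * \int[mu]_x (w x * k (v x) t)%:E).
Proof.
move=> Hk Es s0 mw mv w0 v0; have [mk hk k0 kz] := Hk.
have p (y : R) t : (0 <= y)%R -> (0 <= theta a t * k y t)%R.
  move=> y0; have [t0|t0] := ltP 0%R t; first by rewrite mulr_ge0 ?theta_ge0// k0.
  by rewrite theta0// mul0r.
have mt := measurable_theta a.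
have mkv t : measurable_fun setT (fun x => k (v x) t).
  exact: (measurableT_comp mk (measurable_fun_pair mv (measurable_cst t))).
have mkx y : measurable_fun setT (k y) := measurableT_comp mk (measurable_pair1 _).
pose f (z : R * R) := (w z.1 * (theta a z.2 * k (v z.1) z.2))%R.
have mf : measurable_fun setT (EFin \o f).
  apply/measurable_EFinP; apply: measurable_funM; first exact: measurableT_comp.
  apply: measurable_funM; first exact: measurableT_comp.
  exact: (measurableT_comp mk (measurable_fun_pair (measurableT_comp mv measurable_fst) measurable_snd)).
have f0 z : 0 <= (EFin \o f) z by rewrite lee_fin mulr_ge0// p.
transitivity (\int[mu]_x \int[mu]_t (EFin \o f) (x, t)).
  rewrite -ge0_integralZr//.
  - apply: eq_integral => x _; rewrite /f/=.
    under [RHS]eq_integral do rewrite EFinM.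
    rewrite ge0_integralZl_EFin//.
    + by rewrite (kernel_power Hk Es s0 (v0 x)) EFinM muleA.
    + by move=> t _; rewrite lee_fin p.
    + by apply/measurable_EFinP; apply: measurable_funM => //; exact: mkx.
  - apply/measurable_EFinP; apply: measurable_funM => //.
    exact: (measurableT_comp (measurable_powR s)).
  - by move=> x _; rewrite lee_fin mulr_ge0// powR_ge0.
  - by apply: integral_ge0 => t _; rewrite lee_fin p.
etransitivity.
  exact: (@fubini_tonelli _ _ (measurableTypeR R) (measurableTypeR R) R mu mu (EFin \o f) mf f0).
apply: eq_integral => t _.
rewrite /f/=.
under eq_integral do rewrite mulrCA EFinM.
have [t0|t0] := ltP 0%R t; last first.
  rewrite theta0// mul0e; under eq_integral do rewrite mul0e.
  exact: integral0.
rewrite ge0_integralZl_EFin ?theta_ge0//.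
- by move=> x _; rewrite lee_fin mulr_ge0// k0.
- by apply/measurable_EFinP; apply: measurable_funM => //; exact: mkv.
Qed.

(* The mixtures of the k1 (., t) with weight t ^ (s - 3) give x ^ s for s > 2 only;
   below 2 the weight is not integrable at 0 against k1, hence k2. *)
Definition k0 x t : R := (Num.max 0 (x - t))%R.
Definition k1 x t : R := (Num.max 0 (x - t) ^+ 2)%R.
Definition k2 x t : R := (x ^+ 2 - k1 x t)%R.

Lemma measurable_k1 : measurable_fun setT (fun z : R * R => k1 z.1 z.2).
Proof. by apply: measurable_funX; apply: measurable_maxr => //; exact: measurable_funB. Qed.

Let k1M c x t : (0 < c)%R -> k1 (c * x) (c * t) = (c ^+ 2 * k1 x t)%R.
Proof.
move=> c0; rewrite /k1 -mulrBr -exprMn; congr (_ ^+ 2)%R.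
by rewrite maxr_pMr ?ltW// mulr0.
Qed.

Let k10 t : (0 < t)%R -> k1 0 t = 0%R.
Proof. by move=> t0; rewrite /k1 max_l ?expr0n//; lra. Qed.

Lemma homogeneous_k0 : homogeneous_kernel 1 k0.
Proof.
split.
- by apply: measurable_maxr => //; exact: measurable_funB.
- by move=> c x t c0 _ _; rewrite /k0 -mulrBr maxr_pMr ?ltW// mulr0.
- by move=> x t _ _; rewrite /k0 le_max lexx.
- by move=> t t0; rewrite /k0 max_l//; lra.
Qed.

Lemma homogeneous_k1 : homogeneous_kernel 2 k1.
Proof.
split.
- exact: measurable_k1.
- by move=> c x t c0 _ _; exact: k1M.
- by move=> x t _ _; exact: sqr_ge0.
- exact: k10.
Qed.

Lemma homogeneous_k2 : homogeneous_kernel 2 k2.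
Proof.
split.
- by apply: measurable_funB; [exact: measurable_funX|exact: measurable_k1].
- by move=> c x t c0 _ _; rewrite /k2 k1M// exprMn mulrBr.
- move=> x t x0 t0; rewrite /k2 /k1 subr_ge0.
  by case: (leP (x - t)%R 0%R) => h; nra.
- by move=> t t0; rewrite /k2 k10// expr0n subrr.
Qed.

End kernels.

(** * Improper integrals and the mixture constants *)

Section improper.
Context {R : realType}.
Notation mu := (@lebesgue_measure R).
Local Open Scope ereal_scope.

(** Monotone convergence along compact intervals that avoid the singular ends; a uniform bound on
    the increments of the primitive replaces its limits there. *)
Lemma ge0_integral_le_primitive (f F : R -> R) (lo M : R) (x y : nat -> R) :
  (forall z, lo < z -> is_derive z 1 F (f z))%R ->
  (forall z, lo < z -> {for z, continuous f})%R ->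
  (forall n z, x n <= z <= y n -> 0 <= f z)%R ->
  (forall n, lo < x n)%R -> (forall n, x n < y n)%R ->
  {homo x : m n / (m <= n)%N >-> (n <= m)%R} ->
  {homo y : m n / (m <= n)%N >-> (m <= n)%R} ->
  (forall n, F (y n) - F (x n) <= M)%R ->
  \int[mu]_(z in \bigcup_n `[x n, y n]%classic) (f z)%:E <= M%:E.
Proof.
move=> dF cf f0 lox xy ndx ndy FM.
have cfn n : {within `[x n, y n], continuous f}.
  apply: continuous_in_subspaceT => z; rewrite inE/= in_itv/= => /andP[xz _].
  by apply: cf; exact: lt_le_trans (lox n) xz.
have cv : \int[mu]_(z in `[x n, y n]) (f z)%:E @[n --> \oo] -->
   \int[mu]_(z in \bigcup_n `[x n, y n]%classic) (f z)%:E.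
  apply: ge0_nondecreasing_set_cvg_integral => //.
  - move=> m n mn; apply/subsetPset => z /=; rewrite !in_itv/= => /andP[h1 h2].
    by rewrite (le_trans (ndx _ _ mn) h1) (le_trans h2 (ndy _ _ mn)).
  - move=> n; apply/measurable_EFinP.
    by apply: subspace_continuous_measurable_fun => //; exact: measurable_itv.
rewrite -(cvg_lim _ cv)//; apply: lime_le; first by apply/cvg_ex; eexists; exact: cv.
apply: nearW => n.
have dFn z : (x n <= z)%R -> derivable F z 1.
  by move=> xz; have [] := dF z (lt_le_trans (lox n) xz).
have cF z : (x n <= z)%R -> F w @[w --> z] --> F z.
  by move=> xz; apply: differentiable_continuous; apply/derivable1_diffP; exact: dFn.
rewrite (continuous_FTC2 (xy n) (cfn n) (F := F)).
- by rewrite -EFinD lee_fin FM.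
- split.
  + by move=> z; rewrite in_itv/= => /andP[/ltW xz _]; exact: dFn.
  + by apply: cvg_at_right_filter; exact: cF.
  + by apply: cvg_at_left_filter; apply: cF; exact: ltW.
- move=> z; rewrite in_itv/= => /andP[xz _]; rewrite derive1E.
  by have [_ ->] := dF z (lt_trans (lox n) xz).
Qed.

Lemma ge0_integral_oc_le (f F : R -> R) (a b M : R) : (a < b)%R ->
  (forall z, a < z -> is_derive z 1 F (f z))%R ->
  (forall z, a < z -> {for z, continuous f})%R ->
  (forall z, a < z <= b -> 0 <= f z)%R ->
  (forall z, a < z < b -> F b - F z <= M)%R ->
  \int[mu]_(z in `]a, b]) (f z)%:E <= M%:E.
Proof.
move=> ab dF cf f0 FM.
(* The shift in the index keeps [x 0] below [b], as [harmonic 0] is 1. *)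
pose x n : R := (a + (b - a) * harmonic n.+1)%R.
have h0 n : (0 < harmonic n :> R)%R by rewrite /harmonic invr_gt0 ltr0n.
have h1 n : (harmonic n.+1 < 1 :> R)%R by rewrite /harmonic invf_lt1 ?ltr0n// ltr1n.
have ba : (0 < b - a)%R by rewrite subr_gt0.
have ax n : (a < x n)%R by rewrite /x ltrDl mulr_gt0.
have xb n : (x n < b)%R.
  have : ((b - a) * harmonic n.+1 < (b - a) * 1)%R by rewrite ltr_pM2l.
  by rewrite /x; lra.
rewrite (_ : `]a, b]%classic = \bigcup_n `[x n, (fun=> b) n]%classic).
  apply: (ge0_integral_le_primitive dF cf) => //.
  - by move=> n z /andP[xz zb]; apply: f0; rewrite zb (lt_le_trans (ax n) xz).
  - move=> m n mn; rewrite /x lerD2l ler_pM2l// /harmonic lef_pV2 ?posrE ?ltr0n//.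
    by rewrite ler_nat.
  - by move=> n; apply: FM; rewrite ax xb.
apply/seteqP; split => z /=; last first.
  by move=> [n _] /=; rewrite !in_itv/= => /andP[xz ->]; rewrite (lt_le_trans (ax n) xz).
rewrite in_itv/= => /andP[az zb].
have za : (0 < (z - a) / (b - a))%R by rewrite divr_gt0// subr_gt0.
have /cvgr0Pnorm_lt /(_ _ za) [n _ Hn] := @cvg_harmonic R.
exists n => //=; rewrite in_itv/= zb andbT.
have := Hn n.+1 (leqnSn n); rewrite /= ger0_norm ?(ltW (h0 _))// ltr_pdivlMr// => h.
by rewrite /x -lerBrDl mulrC; exact: ltW.
Qed.

Lemma integral_powR01 (a : R) : (- 1 < a)%R ->
  \int[mu]_(t in `]0%R, 1%R]) (t `^ a)%:E <= ((a + 1)^-1)%:E.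
Proof.
move=> a1; have a0 : (0 < a + 1)%R by lra.
apply: (@ge0_integral_oc_le _ (fun t => (a + 1)^-1 * t `^ (a + 1))%R) => //.
- move=> z z0; have dz := is_derive1_powR (a + 1) z0.
  apply: is_derive_eq.
  by rewrite addrK /GRing.scale/= mulrA mulVf ?mul1r// gt_eqF.
- move=> z z0; apply: differentiable_continuous; apply/derivable1_diffP.
  by have [] := is_derive1_powR a z0.
- by move=> z _; exact: powR_ge0.
- by move=> z _; rewrite powR1 mulr1 gerBl mulr_ge0 ?powR_ge0// invr_ge0 ltW.
Qed.

Lemma integral_powR1y (a : R) : (a < - 1)%R ->
  \int[mu]_(t in `[1%R, +oo[) (t `^ a)%:E <= ((- (a + 1))^-1)%:E.
Proof.
move=> a1; have a0 : (0 < - (a + 1))%R by lra.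
pose o (n : nat) : R := 1%R.
pose y (n : nat) : R := n.+2%:R.
have y1 n : (1 < y n)%R by rewrite /y ltr1n.
rewrite (_ : `[1%R, +oo[%classic = \bigcup_n `[o n, y n]%classic).
  apply: (@ge0_integral_le_primitive _ (fun t => (a + 1)^-1 * t `^ (a + 1))%R 0) => //.
  - move=> z z0; have dz := is_derive1_powR (a + 1) z0.
    apply: is_derive_eq.
    by rewrite addrK /GRing.scale/= mulrA mulVf ?mul1r//; apply/eqP; lra.
  - move=> z z0; apply: differentiable_continuous; apply/derivable1_diffP.
    by have [] := is_derive1_powR a z0.
  - by move=> n z _; exact: powR_ge0.
  - by move=> m n mn; rewrite /y ler_nat.
  - move=> n; rewrite powR1 mulr1 invrN lerBlDr addNr mulr_le0_ge0 ?powR_ge0// invr_le0; lra.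
apply/seteqP; split => z /=; last first.
  by move=> [n _] /=; rewrite !in_itv/= => /andP[-> _].
rewrite in_itv/= andbT => z1.
have [n _ Hn] := nbhs_infty_ger z.
exists n => //=; rewrite in_itv/= z1/=; apply: le_trans (Hn n (leqnn n)) _.
by rewrite /y ler_nat; exact/leqW/leqnSn.
Qed.

Lemma integral_gt0_itv (f : R -> R) (a b c : R) : (0 < c)%R -> (a < b)%R ->
  measurable_fun setT f -> (forall x, 0 <= f x)%R ->
  (forall x, a < x < b -> c <= f x)%R ->
  0 < \int[mu]_x (f x)%:E.
Proof.
move=> c0 ab mf f0 cf.
apply: (@lt_le_trans _ _ (\int[mu]_(x in `]a, b[) c%:E)).
  by rewrite integral_cst//= lebesgue_measure_itv/= lte_fin ab -EFinD -EFinM lte_fin mulr_gt0// subr_gt0.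
apply: (@le_trans _ _ (\int[mu]_(x in `]a, b[) (f x)%:E)).
  apply: ge0_le_integral => //.
  - by move=> x _; rewrite lee_fin ltW.
  - by apply/measurable_EFinP; exact: measurable_funTS.
apply: ge0_subset_integral => //.
- exact/measurable_EFinP.
- by move=> x _; rewrite lee_fin.
Qed.

End improper.

Section constants.
Context {R : realType}.
Notation mu := (@lebesgue_measure R).
Local Open Scope ereal_scope.
Implicit Types (a s t x : R).

(** The constant of [kernel_power]; for [k1] it is the Beta integral B(a + 1, 3). *)
Definition kappa (k : R -> R -> R) a : \bar R := \int[mu]_t (theta a t * k 1%R t)%:E.

Let mker m (k : R -> R -> R) a : homogeneous_kernel m k -> measurable_fun setT (fun t => theta a t * k 1 t)%R.
Proof.
move=> [mk _ _ _]; apply: measurable_funM; first exact: measurable_theta.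
exact: (measurableT_comp mk (measurable_pair1 _)).
Qed.

Let ker_ge0 m (k : R -> R -> R) a t : homogeneous_kernel m k -> (0 <= theta a t * k 1 t)%R.
Proof.
move=> [_ _ k0 _]; have [t0|t0] := ltP 0%R t; first by rewrite mulr_ge0 ?theta_ge0// k0.
by rewrite theta0// mul0r.
Qed.

(** On ]1/4, 1/2[ the kernel is at least 1/4 by hypothesis, and t ^ a >= t ^ |a| >= (1/4) ^ |a|
    whatever the sign of a. *)
Let kappa_gt0 m (k : R -> R -> R) a : homogeneous_kernel m k ->
  (forall t, (4^-1 < t < 2^-1)%R -> (4^-1 <= k 1 t)%R) -> 0 < kappa k a.
Proof.
move=> hk k4; have c0 : (0 < 4^-1 `^ `|a| * 4^-1 :> R)%R by rewrite mulr_gt0// powR_gt0.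
apply: (@integral_gt0_itv _ _ 4^-1%R 2^-1%R _ c0).
- lra.
- exact: mker hk.
- by move=> t; exact: ker_ge0 hk.
- move=> t /andP[t4 t2]; have t0 : (0 < t)%R by lra.
  have k4t : (4^-1 <= k 1 t)%R by apply: k4; rewrite t4.
  apply: ler_pM; [exact: powR_ge0|lra| |exact: k4t].
  rewrite thetaE//; apply: (@le_trans _ _ (t `^ `|a|)%R).
    by apply: ge0_ler_powR; rewrite ?nnegrE ?normr_ge0//; lra.
  by apply: ger_powR; rewrite ?ler_norm// t0; lra.
Qed.

Lemma kappa_k0_gt0 a : 0 < kappa k0 a.
Proof.
apply: kappa_gt0; first exact: homogeneous_k0.
by move=> t /andP[t4 t2]; rewrite /k0 le_max; apply/orP; right; lra.
Qed.

Lemma kappa_k1_gt0 a : 0 < kappa k1 a.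
Proof.
apply: kappa_gt0; first exact: homogeneous_k1.
by move=> t /andP[t4 t2]; rewrite /k1; case: (leP (1 - t)%R 0%R) => h; nra.
Qed.

Lemma kappa_k2_gt0 a : 0 < kappa k2 a.
Proof.
apply: kappa_gt0; first exact: homogeneous_k2.
by move=> t /andP[t4 t2]; rewrite /k2 /k1; case: (leP (1 - t)%R 0%R) => h; nra.
Qed.

Let mpow (D : set R) a : measurable_fun D (fun t => (t `^ a)%:E).
Proof. by apply/measurable_EFinP; apply: measurable_funTS; exact: measurable_powR. Qed.

Lemma kappa_k1_lty a : (- 1 < a)%R -> kappa k1 a < +oo.
Proof.
move=> a1.
have m0 : measurable_fun setT ((fun t : R => (t `^ a)%:E) \_ `]0%R, 1%R]).
  by apply/(measurable_restrictT _ _).1.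
apply: (@le_lt_trans _ _ (\int[mu]_(t in `]0%R, 1%R]) (t `^ a)%:E)); last first.
  by apply: le_lt_trans (integral_powR01 a1) _; rewrite ltry.
rewrite [leRHS]integral_mkcond; apply: ge0_le_integral => //.
- by move=> t _; rewrite lee_fin (ker_ge0 _ _ homogeneous_k1).
- by apply/measurable_EFinP; exact: mker homogeneous_k1.
move=> t _; rewrite patchE; have [t0|t0] := ltP 0%R t; last first.
  by rewrite theta0// mul0r memNset//= in_itv/= ltNge t0.
rewrite thetaE// /k1; have [t1|t1] := leP t 1%R.
  rewrite mem_set/= ?in_itv/= ?t0// lee_fin ler_piMr ?powR_ge0//.
  by case: (leP (1 - t)%R 0%R) => h; nra.
rewrite memNset/=; last by rewrite in_itv/= t0/=; apply/negP; rewrite -ltNge.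
by rewrite max_l ?expr0n/= ?mulr0//; lra.
Qed.

(** [k2 1 t] is at most 2 t near 0 and equals 1 for t >= 1, so the integrand is bounded by 2 t ^ (a
    + 1) at 0 and by t ^ a at infinity. For a = s - 3 the range is 1 < s < 2, without the end s =
    1. *)
Lemma kappa_k2_lty a : (- 2 < a < - 1)%R -> kappa k2 a < +oo.
Proof.
move=> /andP[a2 a1]; have a1' : (- 1 < a + 1)%R by lra.
have i0 : forall t : R, 0 <= ((fun t => (t `^ (a + 1))%:E) \_ `]0%R, 1%R]) t.
  by move=> t; apply: erestrict_ge0 => x _; rewrite lee_fin powR_ge0.
have i1 : forall t : R, 0 <= ((fun t => (t `^ a)%:E) \_ `[1%R, +oo[) t.
  by move=> t; apply: erestrict_ge0 => x _; rewrite lee_fin powR_ge0.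
have m0 : measurable_fun setT ((fun t : R => (t `^ (a + 1))%:E) \_ `]0%R, 1%R]).
  by apply/(measurable_restrictT _ _).1.
have m1 : measurable_fun setT ((fun t : R => (t `^ a)%:E) \_ `[1%R, +oo[).
  by apply/(measurable_restrictT _ _).1.
apply: (@le_lt_trans _ _ (2%:E * (\int[mu]_(t in `]0%R, 1%R]) (t `^ (a + 1))%:E)
   + \int[mu]_(t in `[1%R, +oo[) (t `^ a)%:E)); last first.
  apply: lte_add_pinfty.
    by apply: lte_mul_pinfty => //; apply: le_lt_trans (integral_powR01 a1') _; rewrite ltry.
  by apply: le_lt_trans (integral_powR1y a1) _; rewrite ltry.
rewrite [X in _ <= 2%:E * X + _]integral_mkcond [X in _ <= _ + X]integral_mkcond.
rewrite -ge0_integralZl_EFin// -ge0_integralD//; last 2 first.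
- by move=> t _; rewrite mule_ge0.
- exact: measurable_funeM.
apply: ge0_le_integral => //.
- by move=> t _; rewrite lee_fin (ker_ge0 _ _ homogeneous_k2).
- by apply/measurable_EFinP; exact: mker homogeneous_k2.
- by apply: emeasurable_funD => //; exact: measurable_funeM.
move=> t _; have [t0|t0] := ltP 0%R t; last first.
  by rewrite theta0// mul0r adde_ge0// mule_ge0.
rewrite thetaE// /k2 /k1; have [t1|t1] := leP t 1%R.
  apply: (@le_trans _ _ (2%:E * (t `^ (a + 1))%:E)); last first.
    by rewrite patchE mem_set/= ?in_itv/= ?t0// leeDl.
  rewrite -EFinM lee_fin powRD ?(gt_eqF t0) ?implybT// powRr1 ?(ltW t0)//.
  have := powR_ge0 t a.
  by case: (leP (1 - t)%R 0%R) => h p0; nra.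
apply: (@le_trans _ _ (t `^ a)%:E).
  by rewrite lee_fin ler_piMr ?powR_ge0// expr1n gerBl sqr_ge0.
by rewrite [X in _ + X]patchE mem_set/= ?in_itv/= ?andbT ?(ltW t1)// leeDr// mule_ge0.
Qed.

(** Serves [eg_1_2], the constant of the case p = 1. *)
Lemma kappa_k0_le : kappa k0 0 <= (2^-1)%:E.
Proof.
pose f (t : R) := (1 - t)%R.
apply: (@le_trans _ _ (\int[mu]_(t in `]0%R, 1%R]) (f t)%:E)).
  have mf (D : set R) : measurable_fun D (fun t => (f t)%:E).
    by apply/measurable_EFinP; exact: measurable_funB.
  have m0 : measurable_fun setT ((fun t : R => (f t)%:E) \_ `]0%R, 1%R]).
    by apply/(measurable_restrictT _ _).1.
  rewrite [leRHS]integral_mkcond; apply: ge0_le_integral => //.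
  - by move=> t _; rewrite lee_fin (ker_ge0 _ _ homogeneous_k0).
  - by apply/measurable_EFinP; exact: mker homogeneous_k0.
  move=> t _; rewrite patchE; have [t0|t0] := ltP 0%R t; last first.
    by rewrite theta0// mul0r memNset//= in_itv/= ltNge t0.
  rewrite thetaE// /k0 powRr0 mul1r; have [t1|t1] := leP t 1%R.
    by rewrite mem_set/= ?in_itv/= ?t0// lee_fin max_r//; lra.
  rewrite memNset/=; last by rewrite in_itv/= t0/=; apply/negP; rewrite -ltNge.
  by rewrite max_l//; lra.
apply: (@ge0_integral_oc_le _ _ (fun t => t - 2^-1 * (t * t))%R) => //.
- move=> z z0; apply: is_derive_eq; rewrite /f /GRing.scale/=; lra.
- move=> z z0; apply: cvgB; [exact: cvg_cst|exact: cvg_id].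
- by move=> z /andP[_ z1]; rewrite /f subr_ge0.
- by move=> z /andP[z0 z1]; nra.
Qed.

End constants.

(** * Weighted moments in terms of tails *)

Section moments.
Context {R : realType}.
Notation mu := (@lebesgue_measure R).
Local Open Scope ereal_scope.
Implicit Types (a s t x p r : R) (w v h : R -> R).

(** The density w lets the same lemmas serve the indicator of an interval with |phi|, the
    exponential density with x, and the constant density with the logarithmic profile [V]. *)
Definition wmoment w v s : \bar R := \int[mu]_x (w x * v x `^ s)%:E.

Definition nonneg_pair w v :=
  [/\ measurable_fun setT w, measurable_fun setT v,
      forall x, (0 <= w x)%R & forall x, (0 <= v x)%R].

(** The second order tail as a real function rather than an extended real integral, so that
    differences such as h 0 - h t make sense. *)
Definition has_tail w v h :=
  measurable_fun setT h /\
  forall t, (0 <= t)%R -> \int[mu]_x (w x * k1 (v x) t)%:E = (h t)%:E.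

Lemma wmoment_ge0 w v s : nonneg_pair w v -> 0 <= wmoment w v s.
Proof. by move=> [_ _ w0 v0]; apply: integral_ge0 => x _; rewrite lee_fin mulr_ge0// powR_ge0. Qed.

Let mk1v w v t : nonneg_pair w v -> measurable_fun setT (fun x => (w x * k1 (v x) t)%:E).
Proof.
move=> [mw mv w0 v0]; apply/measurable_EFinP; apply: measurable_funM => //.
by apply: measurable_funX; apply: measurable_maxr => //; exact: measurable_funB.
Qed.

Lemma has_tail_ge0 w v h t : nonneg_pair w v -> has_tail w v h -> (0 <= t)%R -> (0 <= h t)%R.
Proof.
move=> [_ _ w0 v0] [_ Hh] t0; rewrite -lee_fin -Hh//; apply: integral_ge0 => x _.
by rewrite lee_fin mulr_ge0// sqr_ge0.
Qed.

Lemma wmoment2 w v h : nonneg_pair w v -> has_tail w v h -> wmoment w v 2 = (h 0)%:E.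
Proof.
move=> [_ _ w0 v0] [_ <-//]; apply: eq_integral => x _; congr (_ * _)%:E.
by rewrite /k1 subr0 max_r// powR_mulrn.
Qed.

(** Measurability in t is part of Tonelli's theorem; finiteness holds because k1(x, t) <= x ^ 2 for
    x, t >= 0. *)
Lemma has_tail_exists w v : nonneg_pair w v -> wmoment w v 2 < +oo ->
  exists h, has_tail w v h.
Proof.
move=> wv fin; have [mw mv w0 v0] := wv.
pose H t := \int[mu]_x (w x * k1 (v x) t)%:E.
pose f (z : R * R) := (w z.1 * k1 (v z.1) z.2)%R.
have mf : measurable_fun setT (EFin \o f).
  apply/measurable_EFinP; apply: measurable_funM; first exact: measurableT_comp.
  exact: (measurableT_comp measurable_k1 (measurable_fun_pair (measurableT_comp mv measurable_fst) measurable_snd)).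
have f0 z : 0 <= (EFin \o f) z by rewrite lee_fin mulr_ge0// sqr_ge0.
have mH : measurable_fun setT H.
  exact: (@measurable_fun_fubini_tonelli_G _ _ (measurableTypeR R) (measurableTypeR R) R mu (EFin \o f) mf f0).
exists (fine \o H); split; first exact: measurableT_comp.
move=> t t0 /=; rewrite fineK// ge0_fin_numE; last first.
  by apply: integral_ge0 => x _; rewrite lee_fin mulr_ge0// sqr_ge0.
apply: le_lt_trans fin; apply: ge0_le_integral => //.
- by move=> x _; rewrite lee_fin mulr_ge0// sqr_ge0.
- exact: mk1v.
- apply/measurable_EFinP; apply: measurable_funM => //.
  exact: (measurableT_comp (measurable_powR 2)).
- move=> x _; rewrite lee_fin ler_wpM2l// powR_mulrn// /k1.
  by have := v0 x; case: (leP (v x - t)%R 0%R) => h1; nra.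
Qed.

Lemma wmoment_k1 w v h s : nonneg_pair w v -> has_tail w v h -> (2 < s)%R ->
  wmoment w v s * kappa k1 (s - 3) = \int[mu]_t (theta (s - 3) t * h t)%:E.
Proof.
move=> [mw mv w0 v0] [mh Hh] s2.
rewrite (@kernel_moment _ 2 _ (s - 3) s _ _ homogeneous_k1)//; [|lra|lra].
apply: eq_integral => t _; have [t0|t0] := ltP 0%R t.
  by rewrite Hh ?ltW.
by rewrite theta0// mul0e mul0r.
Qed.

Lemma wmoment_k2 w v h s : nonneg_pair w v -> has_tail w v h -> (1 < s)%R ->
  wmoment w v s * kappa k2 (s - 3) = \int[mu]_t (theta (s - 3) t * (h 0 - h t))%:E.
Proof.
move=> wv [mh Hh] s2; have [mw mv w0 v0] := wv.
rewrite (@kernel_moment _ 2 _ (s - 3) s _ _ homogeneous_k2)//; [|lra|lra].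
apply: eq_integral => t _; have [t0|t0] := ltP 0%R t; last first.
  by rewrite theta0// mul0e mul0r.
suff E : \int[mu]_x (w x * k2 (v x) t)%:E = (h 0 - h t)%:E by rewrite E EFinM.
rewrite EFinB -!Hh ?(ltW t0)//.
have [_ _ k20 _] := @homogeneous_k2 R.
have -> : \int[mu]_x (w x * k1 (v x) 0)%:E =
    \int[mu]_x (w x * k2 (v x) t)%:E + \int[mu]_x (w x * k1 (v x) t)%:E.
  rewrite -ge0_integralD//.
  - apply: eq_integral => x _; rewrite -EFinD -mulrDr /k2 subrK.
    by congr (_ * _)%:E; rewrite /k1 subr0 max_r.
  - by move=> x _; rewrite lee_fin mulr_ge0// k20.
  - apply/measurable_EFinP; apply: measurable_funM => //.
    apply: measurable_funB; first exact: measurable_funX.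
    by apply: measurable_funX; apply: measurable_maxr => //; exact: measurable_funB.
  - by move=> x _; rewrite lee_fin mulr_ge0// sqr_ge0.
  - exact: mk1v.
by rewrite addeK// Hh ?ltW.
Qed.

(** The integral of max(0, x - t) over t > 0 is a multiple of x ^ 2: this links the first order tail
    to the second moment. *)
Lemma wmoment_k0 w v : nonneg_pair w v ->
  wmoment w v 2 * kappa k0 0 = \int[mu]_t ((theta 0 t)%:E * \int[mu]_x (w x * k0 (v x) t)%:E).
Proof.
move=> [mw mv w0 v0].
by rewrite (@kernel_moment _ 1 _ 0 2 _ _ homogeneous_k0)//; lra.
Qed.

End moments.

(** * Comparison with the exponential distribution *)

Section exponential_weight.
Context {R : realType}.
Notation mu := (@lebesgue_measure R).
Local Open Scope ereal_scope.
Implicit Types (a s t x p r : R).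

Definition expw x : R := (\1_`]0%R, +oo[%classic x * expR (- x))%R.
Definition posp x : R := Num.max 0%R x.

Lemma expw0 x : (x <= 0)%R -> expw x = 0%R.
Proof. by move=> x0; rewrite /expw indicE memNset ?mul0r//= in_itv/= andbT ltNge x0. Qed.

Lemma expwE x : (0 < x)%R -> expw x = expR (- x).
Proof. by move=> x0; rewrite /expw indicE mem_set ?mul1r//= in_itv/= andbT. Qed.

Lemma expw_ge0 x : (0 <= expw x)%R.
Proof. by rewrite /expw mulr_ge0 ?expR_ge0// indicE. Qed.

Lemma measurable_expw : measurable_fun setT expw.
Proof.
apply: measurable_funM => //.
apply: continuous_measurable_fun => x.
by apply: continuous_comp; [exact: opp_continuous|exact: continuous_expR].
Qed.

Lemma posp_ge0 x : (0 <= posp x)%R. Proof. by rewrite /posp le_max lexx. Qed.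

Lemma measurable_posp : measurable_fun setT posp.
Proof. exact: measurable_maxr. Qed.

Lemma nonneg_pair_exp : nonneg_pair expw posp.
Proof.
by split; [exact: measurable_expw|exact: measurable_posp|exact: expw_ge0|exact: posp_ge0].
Qed.

Definition egamma s := wmoment expw posp s.

Lemma integral_expw : \int[mu]_x (expw x)%:E = 1.
Proof.
rewrite -(@integral_exponential_pdf R 1 ltr01).
have m1 : measurable_fun setT (EFin \o expw) by apply/measurable_EFinP; exact: measurable_expw.
apply: ae_eq_integral => //.
  by apply/measurable_EFinP; exact: measurable_exponential_pdf.
exists [set 0%R]; split; [exact: measurable_set1|exact: lebesgue_measure_set1|].
move=> x /= nx; apply/eqP; apply: contra_notT nx => x0 _; congr EFin.
move: x0; rewrite neq_lt => /orP[x0|x0].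
  by rewrite expw0 ?ltW// lt0_exponential_pdf.
by rewrite expwE// exponential_pdfE ?ltW// mul1r mulN1r.
Qed.

Lemma egamma_lty s : (0 < s)%R -> egamma s < +oo.
Proof.
move=> s0.
have r0 : (0 < 2^-1 :> R)%R by lra.
(* From 1 + y <= expR y at y = x / (2 s) follows x ^ s <= (2 s) ^ s * expR (x / 2); the product with
   expR (- x) is a multiple of the exponential density of rate 1/2. *)
apply: (@le_lt_trans _ _ (\int[mu]_x (2 * (2 * s) `^ s * exponential_pdf 2^-1 x)%:E)); last first.
  under eq_integral do rewrite EFinM.
  rewrite ge0_integralZl_EFin//.
  - by rewrite integral_exponential_pdf// mule1 ltry.
  - by move=> x _; rewrite lee_fin exponential_pdf_ge0// ltW.
  - by apply/measurable_EFinP; exact: measurable_exponential_pdf.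
  - by rewrite mulr_ge0// powR_ge0.
have [mw mv w0 v0] := nonneg_pair_exp.
apply: ge0_le_integral => //.
- by move=> x _; rewrite lee_fin mulr_ge0// powR_ge0.
- apply/measurable_EFinP; apply: measurable_funM => //.
  exact: (measurableT_comp (measurable_powR s)).
- apply/measurable_EFinP; apply: measurable_funM => //; exact: measurable_exponential_pdf.
move=> x _; rewrite lee_fin; have [x0|x0] := ltP 0%R x; last first.
  by rewrite expw0// mul0r mulr_ge0 ?exponential_pdf_ge0 ?mulr_ge0 ?powR_ge0// ltW.
rewrite expwE// exponential_pdfE ?(ltW x0)// /posp max_r ?(ltW x0)//.
have s2 : (0 < 2 * s)%R by lra.
have H : (x `^ s <= (2 * s) `^ s * expR (x / 2))%R.
  have -> : (x / 2 = x / (2 * s) * s)%R.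
    by rewrite invfM -!mulrA mulVf ?mulr1// gt_eqF.
  rewrite expRM -powRM ?expR_ge0 ?(ltW s2)//; apply: ge0_ler_powR; rewrite ?nnegrE ?(ltW s0) ?(ltW x0)//.
    by rewrite mulr_ge0 ?expR_ge0// ltW.
  have := expR_ge1Dx (x / (2 * s))%R.
  rewrite -(ler_pM2l s2) mulrDr mulrCA divff ?gt_eqF// mulr1; lra.
have -> : (2 * (2 * s) `^ s * (2^-1 * expR (- 2^-1 * x)) = expR (- x) * ((2 * s) `^ s * expR (x / 2)))%R.
  rewrite [RHS]mulrCA -expRD; have -> : (- x + x / 2 = - 2^-1 * x)%R by lra.
  lra.
by rewrite ler_pM2l// expR_gt0.
Qed.

Lemma egamma_gt0 s : (0 < s)%R -> 0 < egamma s.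
Proof.
move=> s0; have [mw mv w0 v0] := nonneg_pair_exp.
apply: (@integral_gt0_itv _ _ 1%R 2%R (expR (- 2))) => //.
- by rewrite ltr1n.
- apply: measurable_funM => //; exact: (measurableT_comp (measurable_powR s)).
- by move=> x; rewrite mulr_ge0// powR_ge0.
move=> x /andP[x1 x2]; have x0 : (0 < x)%R by lra.
rewrite expwE// -[leLHS]mulr1; apply: ler_pM => //; rewrite ?expR_ge0//.
  by rewrite ler_expR; lra.
rewrite /posp max_r ?(ltW x0)//.
rewrite -[leLHS](powRr0 x); apply: ler_powR; exact: ltW.
Qed.

(* Memorylessness of the exponential distribution. *)
Lemma expw_tail (g : R -> R) t : measurable_fun setT g -> (forall x, 0 <= g x)%R ->
  g 0%R = 0%R -> (0 <= t)%R ->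
  \int[mu]_x (expw x * g (Num.max 0 (posp x - t)))%:E =
  (expR (- t))%:E * \int[mu]_x (expw x * g (posp x))%:E.
Proof.
move=> mg g0 g00 t0; have [mw mv w0 v0] := nonneg_pair_exp.
have := @ge0_integral_affine R 1 t (fun x => (expw x * g (Num.max 0 (posp x - t)))%:E) ltr01.
rewrite invr1 mul1e => <-.
- rewrite -ge0_integralZl_EFin ?expR_ge0//.
  + apply: eq_integral => x _; rewrite mul1r -EFinM; congr EFin.
    have [x0|x0] := ltP 0%R x.
      have xt : (0 < x + t)%R by lra.
      rewrite !expwE// /posp (max_r (ltW xt)) addrK (max_r (ltW x0)).
      by rewrite opprD expRD; lra.
    rewrite (expw0 x0) mul0r mulr0 [X in g X](_ : _ = 0%R) ?g00 ?mulr0//.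
    by rewrite /posp; apply/max_idPl; case: (leP (x + t)%R 0%R) => h; lra.
  + by move=> x _; rewrite lee_fin mulr_ge0.
  + apply/measurable_EFinP; apply: measurable_funM => //; exact: measurableT_comp.
- apply/measurable_EFinP; apply: measurable_funM => //; apply: measurableT_comp => //.
  by apply: measurable_maxr => //; exact: measurable_funB.
- by move=> x; rewrite lee_fin mulr_ge0.
Qed.

End exponential_weight.

Section comparison.
Context {R : realType}.
Notation mu := (@lebesgue_measure R).
Local Open Scope ereal_scope.
Implicit Types (a s t x p r : R) (w v h : R -> R).

Lemma egamma_real : {e : R -> R | forall s, (0 < s)%R -> egamma s = (e s)%:E}.
Proof.
exists (fun s => fine (egamma s)) => s s0.
by rewrite fineK// ge0_fin_numE ?egamma_lty// ltW// egamma_gt0.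
Qed.

(** Gamma(s + 1) for s > 0. It comes from an opaque existence lemma, so [egE] is all that is known
    about it. *)
Definition eg : R -> R := sval egamma_real.

Lemma egE s : (0 < s)%R -> egamma s = (eg s)%:E.
Proof. exact: (svalP egamma_real). Qed.

Lemma eg_gt0 s : (0 < s)%R -> (0 < eg s)%R.
Proof. by move=> s0; rewrite -lte_fin -egE// egamma_gt0. Qed.

Let kreal (k : \bar R) : 0 < k -> k < +oo -> exists2 c : R, (0 < c)%R & k = c%:E.
Proof. by case: k => [c| |]//; rewrite lte_fin => c0 _; exists c. Qed.

Let mulIe (k : R) (x y : \bar R) : (0 < k)%R -> x * k%:E = y * k%:E -> x = y.
Proof.
move=> k0 /(congr1 (fun z => z * k^-1%:E)).
by rewrite -!muleA -!EFinM divff ?gt_eqF// !mule1.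
Qed.

Let lee_cancel (k : R) (x y : \bar R) : (0 < k)%R -> (k%:E * x <= k%:E * y) = (x <= y).
Proof. by move=> k0; rewrite lee_pmul2l// lte_fin. Qed.

Let lee_chain (a b c : R) (x y z : \bar R) : (0 <= a)%R -> (0 < b)%R -> (0 <= c)%R ->
  b%:E * x <= c%:E * y -> a%:E * y <= b%:E * z -> a%:E * x <= c%:E * z.
Proof.
move=> a0 b0 c0 bx ay; rewrite -(lee_cancel _ _ b0) muleCA [leRHS]muleCA.
apply: (@le_trans _ _ (a%:E * (c%:E * y))); first exact: lee_wpmul2l.
by rewrite [leLHS]muleCA; exact: lee_wpmul2l.
Qed.

Let lee_cross (e ep er ap ar kp kr : R) (x y : \bar R) :
  (0 < e)%R -> (0 < kp)%R -> (0 < kr)%R ->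
  (e * ap = ep * kp)%R -> (e * ar = er * kr)%R ->
  ap%:E * (kr%:E * x) <= ar%:E * (kp%:E * y) -> ep%:E * x <= er%:E * y.
Proof.
move=> e0 kp0 kr0 Ep Er; rewrite -(lee_cancel _ _ e0) !muleA -!EFinM Ep Er => H.
rewrite -(lee_cancel _ _ (mulr_gt0 kp0 kr0)) !muleA -!EFinM.
have -> : (kp * kr * ep = ep * kp * kr)%R by lra.
by have -> : (kp * kr * er = er * kr * kp)%R by lra.
Qed.

Let mexp : measurable_fun setT (fun t : R => expR (- t)).
Proof.
apply: continuous_measurable_fun => x.
by apply: continuous_comp; [exact: opp_continuous|exact: continuous_expR].
Qed.

Let intZ (c : R) (f : R -> R) : (0 <= c)%R -> measurable_fun setT f ->
  (forall t, 0 <= f t)%R -> \int[mu]_t (c * f t)%:E = c%:E * \int[mu]_t (f t)%:E.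
Proof.
move=> c0 mf f0; under eq_integral do rewrite EFinM.
by rewrite ge0_integralZl_EFin//; [move=> t _; rewrite lee_fin|exact/measurable_EFinP].
Qed.

Let intD (f g : R -> R) : measurable_fun setT f -> measurable_fun setT g ->
  (forall t, 0 <= f t)%R -> (forall t, 0 <= g t)%R ->
  \int[mu]_t (f t)%:E + \int[mu]_t (g t)%:E = \int[mu]_t (f t + g t)%:E.
Proof.
move=> mf mg f0 g0; under [RHS]eq_integral do rewrite EFinD.
by rewrite ge0_integralD//;
  [move=> t _; rewrite lee_fin|exact/measurable_EFinP|move=> t _; rewrite lee_fin|exact/measurable_EFinP].
Qed.

Let int_le (f g : R -> R) : measurable_fun setT f -> measurable_fun setT g ->
  (forall t, 0 <= f t)%R -> (forall t, f t <= g t)%R ->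
  \int[mu]_t (f t)%:E <= \int[mu]_t (g t)%:E.
Proof.
move=> mf mg f0 fg; apply: ge0_le_integral => //.
- by move=> t _; rewrite lee_fin.
- exact/measurable_EFinP.
- exact/measurable_EFinP.
- by move=> t _; rewrite lee_fin.
Qed.

Lemma exp_has_tail : has_tail expw posp (fun t => expR (- t) * eg 2)%R.
Proof.
split; first exact: measurable_funM.
move=> t t0; rewrite EFinM -egE ?ltr0n// /k1.
rewrite (@expw_tail R (fun y => y ^+ 2)%R)//.
- congr (_ * _); apply: eq_integral => x _; rewrite powR_mulrn//; exact: posp_ge0.
- by move=> x; exact: sqr_ge0.
- by rewrite expr0n.
Qed.

(** For a > -1 this is Gamma(a + 1), and for -2 < a < -1 the next integral is - Gamma(a + 1), with
    Gamma continued analytically. *)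
Definition laplace a : \bar R := \int[mu]_t (theta a t * expR (- t))%:E.
Definition claplace a : \bar R := \int[mu]_t (theta a t * (1 - expR (- t)))%:E.

Let mlap a : measurable_fun setT (fun t => theta a t * expR (- t))%R.
Proof. by apply: measurable_funM => //; exact: measurable_theta. Qed.

Let mclap a : measurable_fun setT (fun t => theta a t * (1 - expR (- t)))%R.
Proof.
apply: measurable_funM; first exact: measurable_theta.
exact: measurable_funB.
Qed.

Let clap_ge0 a t : (0 <= theta a t * (1 - expR (- t)))%R.
Proof.
have [t0|t0] := ltP 0%R t; last by rewrite theta0// mul0r.
by rewrite mulr_ge0 ?theta_ge0// subr_ge0 -expR0 ler_expR; lra.
Qed.

Let lap_ge0 a t : (0 <= theta a t * expR (- t))%R.
Proof. by rewrite mulr_ge0 ?theta_ge0// expR_ge0. Qed.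

Lemma exp_tail_k1 w v (c : R) s : nonneg_pair w v ->
  has_tail w v (fun t => expR (- t) * c)%R -> (2 < s)%R ->
  wmoment w v s * kappa k1 (s - 3) = c%:E * laplace (s - 3).
Proof.
move=> wv Hh s2; rewrite (wmoment_k1 wv Hh s2).
have c0 : (0 <= c)%R by have := has_tail_ge0 wv Hh (lexx 0%R); rewrite oppr0 expR0 mul1r.
rewrite /laplace -intZ//.
by apply: eq_integral => t _; congr EFin; lra.
Qed.

Lemma exp_tail_k2 w v (c : R) s : nonneg_pair w v ->
  has_tail w v (fun t => expR (- t) * c)%R -> (1 < s)%R ->
  wmoment w v s * kappa k2 (s - 3) = c%:E * claplace (s - 3).
Proof.
move=> wv Hh s2; rewrite (wmoment_k2 wv Hh s2).
have c0 : (0 <= c)%R by have := has_tail_ge0 wv Hh (lexx 0%R); rewrite oppr0 expR0 mul1r.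
rewrite /claplace -intZ//.
by apply: eq_integral => t _; congr EFin; rewrite oppr0 expR0; lra.
Qed.

Lemma exp_tail_k0 w v (c : R) : nonneg_pair w v ->
  (forall t, (0 <= t)%R -> \int[mu]_x (w x * k0 (v x) t)%:E = (expR (- t) * c)%:E) ->
  wmoment w v 2 * kappa k0 0 = c%:E.
Proof.
move=> wv Hc; have [_ _ w0 v0] := wv.
have c0 : (0 <= c)%R.
  have := Hc 0%R (lexx _); rewrite oppr0 expR0 mul1r => E.
  rewrite -lee_fin -E; apply: integral_ge0 => x _.
  by rewrite lee_fin mulr_ge0// /k0 le_max lexx.
rewrite wmoment_k0//.
transitivity (\int[mu]_t (c%:E * (expw t)%:E)).
  apply: eq_integral => t _; have [t0|t0] := ltP 0%R t; last first.
    by rewrite theta0// expw0// mul0e mule0.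
  by rewrite Hc ?(ltW t0)// thetaE// powRr0 mul1e expwE// -EFinM mulrC.
rewrite ge0_integralZl_EFin//.
- by rewrite integral_expw mule1.
- by move=> t _; rewrite lee_fin expw_ge0.
- by apply/measurable_EFinP; exact: measurable_expw.
Qed.

Let kappa0_real : exists2 c : R, (0 < c <= 2^-1)%R & kappa k0 0 = c%:E.
Proof.
have [||c c0 E] := @kreal (kappa k0 0); first exact: kappa_k0_gt0.
  by apply: le_lt_trans kappa_k0_le _; rewrite ltry.
by exists c => //; rewrite c0 -lee_fin -E kappa_k0_le.
Qed.

Let eg_k0 (c : R) : kappa k0 0 = c%:E -> (eg 2 * c = eg 1)%R.
Proof.
move=> Ec; apply: EFin_inj; rewrite EFinM -egE ?ltr0n// -Ec.
apply: (exp_tail_k0 nonneg_pair_exp) => t t0.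
have pospK y : (0 <= y)%R -> posp y = y by move=> y0; rewrite /posp max_r.
transitivity (\int[mu]_x (expw x * posp (Num.max 0 (posp x - t)))%:E).
  by apply: eq_integral => x _; rewrite [posp (Num.max _ _)]pospK// le_max lexx.
rewrite expw_tail//; [|exact: measurable_posp|exact: posp_ge0|by rewrite pospK].
rewrite EFinM -egE//; congr (_ * _); apply: eq_integral => x _.
by rewrite powRr1 ?posp_ge0// pospK// posp_ge0.
Qed.

(** Applying [exp_tail_k0] to the exponential distribution expresses eg 1 as eg 2 times
    [kappa k0 0]; this takes the place of the functional equation of Gamma. *)
Lemma eg_1_2 : (2 * eg 1 <= eg 2)%R.
Proof.
have [c /andP[c0 c2] Ec] := kappa0_real.
by rewrite -(eg_k0 Ec); have := eg_gt0 (ltr0n R 2); nra.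
Qed.

Let kappa1_real s : (2 < s)%R -> exists2 c : R, (0 < c)%R & kappa k1 (s - 3) = c%:E.
Proof.
by move=> s2; apply: kreal; [exact: kappa_k1_gt0|apply: kappa_k1_lty; lra].
Qed.

Let kappa2_real s : (1 < s < 2)%R -> exists2 c : R, (0 < c)%R & kappa k2 (s - 3) = c%:E.
Proof.
by move=> /andP[? ?]; apply: kreal; [exact: kappa_k2_gt0|apply: kappa_k2_lty; lra].
Qed.

(** The exponential distribution calibrates the mixture: its moment of order s is eg s by
    definition, so the unknown [kappa] and [laplace] are tied by [exp_tail_k1]. *)
Let laplace_real s (c : R) : (2 < s)%R -> kappa k1 (s - 3) = c%:E -> 
  laplace (s - 3) = (eg s * c / eg 2)%:E.
Proof.
move=> s2 Ec; have s0 : (0 < s)%R by lra.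
have e2 := eg_gt0 (ltr0n R 2).
apply: (mulIe e2); rewrite -EFinM divfK ?gt_eqF// muleC.
rewrite -(exp_tail_k1 nonneg_pair_exp exp_has_tail s2) Ec EFinM; congr (_ * _).
exact: egE.
Qed.

Let claplace_real s (c : R) : (1 < s)%R -> kappa k2 (s - 3) = c%:E -> 
  claplace (s - 3) = (eg s * c / eg 2)%:E.
Proof.
move=> s2 Ec; have s0 : (0 < s)%R by lra.
have e2 := eg_gt0 (ltr0n R 2).
apply: (mulIe e2); rewrite -EFinM divfK ?gt_eqF// muleC.
rewrite -(exp_tail_k2 nonneg_pair_exp exp_has_tail s2) Ec EFinM; congr (_ * _).
exact: egE.
Qed.

(** For the extremal function. The second order tail gives all moments with s > 1; the first order
    tail gives s = 1, where the [k2] mixture diverges, and [k0] shows that the two normalizations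
    agree. *)
Lemma exp_tail_moment w v (c1 c2 s : R) : nonneg_pair w v ->
  (forall t, (0 <= t)%R -> \int[mu]_x (w x * k0 (v x) t)%:E = (expR (- t) * c1)%:E) ->
  has_tail w v (fun t => expR (- t) * c2)%R -> (1 <= s)%R ->
  wmoment w v s = (c1 / eg 1 * eg s)%:E.
Proof.
move=> wv Hc1 Hc2 s1; have [_ _ w0 v0] := wv.
have e2 := eg_gt0 (ltr0n R 2); have e1 := eg_gt0 (@ltr01 R).
have W2 : wmoment w v 2 = c2%:E by rewrite (wmoment2 wv Hc2) oppr0 expR0 mul1r.
have [c /andP[c0 _] Ec] := kappa0_real.
have E1 : (c1 / eg 1 = c2 / eg 2)%R.
  have : c2%:E * kappa k0 0 = c1%:E by rewrite -W2; exact: exp_tail_k0.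
  rewrite Ec -EFinM => -[E].
  by rewrite -E -(eg_k0 Ec) invfM mulrA mulrAC mulfK ?gt_eqF.
move: s1; rewrite le_eqVlt => /predU1P[<-|s1].
  rewrite divfK ?gt_eqF//; have := Hc1 0%R (lexx _); rewrite oppr0 expR0 mul1r => <-.
  by apply: eq_integral => x _; rewrite powRr1// /k0 subr0 max_r.
rewrite E1; have [s2|s2|->] := ltgtP s 2%R; last first.
- by rewrite divfK ?gt_eqF.
- have [k k_gt0 Ek] := kappa1_real s2; apply: (mulIe k_gt0).
  rewrite -Ek (exp_tail_k1 wv Hc2 s2) (laplace_real s2 Ek) Ek -!EFinM; congr EFin; lra.
- have [|k k_gt0 Ek] := @kappa2_real s; first by rewrite s1.
  apply: (mulIe k_gt0).
  rewrite -Ek (exp_tail_k2 wv Hc2 s1) (claplace_real s1 Ek) Ek -!EFinM; congr EFin; lra.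
Qed.

Section decay.
Variables (w v h : R -> R).
Hypotheses (wv : nonneg_pair w v) (Hh : has_tail w v h).
Hypothesis decay : forall t s, (0 <= t <= s)%R -> (h s <= expR (t - s) * h t)%R.

Let h0 t : (0 <= t)%R -> (0 <= h t)%R.
Proof. by move=> t0; exact: (has_tail_ge0 wv Hh t0). Qed.

Let mh : measurable_fun setT h. Proof. by have [] := Hh. Qed.

Let mth a : measurable_fun setT (fun t => theta a t * h t)%R.
Proof. by apply: measurable_funM => //; exact: measurable_theta. Qed.

Let th_ge0 a t : (0 <= theta a t * h t)%R.
Proof.
have [t0|t0] := ltP 0%R t; last by rewrite theta0// mul0r.
by rewrite mulr_ge0 ?theta_ge0// h0// ltW.
Qed.

(** Decay from 0 gives h t <= expR (- t) * h 0, with equality for the exponential tail. The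
    complementary kernels see h 0 - h t, so the bound on h from above becomes a lower bound on the
    moment of order p. *)
Let moment_le_p2 p : (1 < p < 2)%R ->
  (eg p)%:E * wmoment w v 2 <= (eg 2)%:E * wmoment w v p.
Proof.
move=> p12; have /andP[p1 p2] := p12; have p0 : (0 < p)%R by lra.
have [k k_gt0 Ek] := @kappa2_real p p12.
have e2 := eg_gt0 (ltr0n R 2).
have H : (h 0)%:E * claplace (p - 3) <= wmoment w v p * k%:E.
  rewrite -Ek (wmoment_k2 wv Hh p1) /claplace -intZ ?h0//; apply: int_le.
  - exact: measurable_funM.
  - apply: measurable_funM; [exact: measurable_theta|exact: measurable_funB].
  - by move=> t; rewrite mulr_ge0// h0.
  move=> t; rewrite mulrCA; have [t0|t0] := ltP 0%R t; last first.
    by rewrite theta0// !mul0r.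
  rewrite ler_wpM2l ?theta_ge0//.
  have := @decay 0 t; rewrite lexx (ltW t0) sub0r => /(_ isT); lra.
rewrite -(lee_cancel _ _ k_gt0) (wmoment2 wv Hh) muleA [X in _ <= X]muleCA.
rewrite [k%:E * wmoment _ _ _]muleC.
apply: le_trans (lee_wpmul2l _ H); last by rewrite lee_fin ltW.
rewrite (claplace_real p1 Ek) -!EFinM lee_fin le_eqVlt; apply/orP; left; apply/eqP.
by rewrite mulrCA [(eg 2 * _)%R]mulrC divfK ?gt_eqF//; lra.
Qed.

Let moment_le_2r r : (2 < r)%R ->
  (eg 2)%:E * wmoment w v r <= (eg r)%:E * wmoment w v 2.
Proof.
move=> r2; have r0 : (0 < r)%R by lra.
have [k k_gt0 Ek] := @kappa1_real r r2.
have e2 := eg_gt0 (ltr0n R 2).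
have H : wmoment w v r * k%:E <= (h 0)%:E * laplace (r - 3).
  rewrite -Ek (wmoment_k1 wv Hh r2) /laplace -intZ ?h0//; apply: int_le => //.
    exact: measurable_funM.
  move=> t; rewrite mulrCA; have [t0|t0] := ltP 0%R t; last first.
    by rewrite theta0// !mul0r.
  rewrite ler_wpM2l ?theta_ge0//.
  have := @decay 0 t; rewrite lexx (ltW t0) sub0r => /(_ isT); lra.
rewrite -(lee_cancel _ _ k_gt0) (wmoment2 wv Hh) muleCA [k%:E * wmoment _ _ _]muleC.
apply: le_trans (lee_wpmul2l _ H) _; first by rewrite lee_fin ltW.
rewrite (laplace_real r2 Ek) -!EFinM lee_fin le_eqVlt; apply/orP; left; apply/eqP.
by rewrite mulrCA [(eg 2 * _)%R]mulrC divfK ?gt_eqF//; lra.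
Qed.

(* The difference of the two normalized weights changes sign exactly once, at
   [t0], and [t |-> expR t * h t] is nonincreasing. *)
Let moment_le_pr p r : (2 < p)%R -> (p < r)%R ->
  (eg p)%:E * wmoment w v r <= (eg r)%:E * wmoment w v p.
Proof.
move=> p2 pr; have r2 : (2 < r)%R by lra.
have [p_gt0 r_gt0] : (0 < p)%R /\ (0 < r)%R by split; lra.
have [kp kp0 Ekp] := @kappa1_real p p2.
have [kr kr0 Ekr] := @kappa1_real r r2.
have e2 := eg_gt0 (ltr0n R 2).
have [ap ap0 [Lp Ep]] : exists2 ap : R, (0 < ap)%R &
    laplace (p - 3) = ap%:E /\ (eg 2 * ap = eg p * kp)%R.
  exists (eg p * kp / eg 2)%R; first by rewrite divr_gt0// mulr_gt0// eg_gt0.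
  by split; [exact: laplace_real|rewrite mulrC divfK ?gt_eqF].
have [ar ar0 [Lr Er]] : exists2 ar : R, (0 < ar)%R &
    laplace (r - 3) = ar%:E /\ (eg 2 * ar = eg r * kr)%R.
  exists (eg r * kr / eg 2)%R; first by rewrite divr_gt0// mulr_gt0// eg_gt0.
  by split; [exact: laplace_real|rewrite mulrC divfK ?gt_eqF].
have [ap_ge0 ar_ge0] := (ltW ap0, ltW ar0).
pose t0 := ((ar / ap) `^ (r - p)^-1)%R.
have rp : (0 < r - p)%R by lra.
have t00 : (0 < t0)%R by rewrite powR_gt0// divr_gt0.
have t0E : (t0 `^ (r - p) = ar / ap)%R.
  by rewrite -powRrM mulVf ?gt_eqF// powRr1// ltW// divr_gt0.
(* Makes c * expR (- t) agree with h at t0; by the decay it lies below h before t0 and above h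
   after. *)
pose c := (expR t0 * h t0)%R.
have c0 : (0 <= c)%R by rewrite mulr_ge0 ?expR_ge0// h0 ?ltW.
have cross : ap%:E * (kr%:E * wmoment w v r) <= ar%:E * (kp%:E * wmoment w v p).
  rewrite [kr%:E * _]muleC [kp%:E * _]muleC -Ekr -Ekp (wmoment_k1 wv Hh r2) (wmoment_k1 wv Hh p2).
  (* The same finite number is added to both sides, written once with [laplace (p - 3)] and once
     with [laplace (r - 3)]. The comparison with c * expR (- t) thus becomes a pointwise inequality
     between nonnegative integrands. *)
  have fin : (ar * c)%:E * laplace (p - 3) \is a fin_num by rewrite Lp -EFinM.
  rewrite -(leeD2rE _ _ fin).
  have -> : ar%:E * \int[mu]_t (theta (p - 3) t * h t)%:E + (ar * c)%:E * laplace (p - 3) =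
     ar%:E * \int[mu]_t (theta (p - 3) t * h t)%:E + (ap * c)%:E * laplace (r - 3).
    by congr (_ + _); rewrite Lp Lr -!EFinM; congr EFin; lra.
  have apc0 : (0 <= ap * c)%R by rewrite mulr_ge0.
  have arc0 : (0 <= ar * c)%R by rewrite mulr_ge0.
  have mZ (k : R) (f : R -> R) : measurable_fun setT f -> measurable_fun setT (fun t => k * f t)%R.
    by move=> mf; exact: measurable_funM.
  have pZ (k : R) (f : R -> R) : (0 <= k)%R -> (forall t, 0 <= f t)%R -> forall t, (0 <= k * f t)%R.
    by move=> k0 f0 t; rewrite mulr_ge0.
  rewrite /laplace -!intZ//.
  rewrite !intD; try (by apply: mZ); try (by apply: pZ).
  apply: int_le.
  - by apply: measurable_funD; exact: mZ.
  - by apply: measurable_funD; exact: mZ.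
  - by move=> t; rewrite addr_ge0// mulr_ge0.
  move=> t.
  have [t_gt0|t_le0] := ltP 0%R t; last by rewrite !theta0// !mul0r !mulr0.
  rewrite !thetaE//.
  have -> : (t `^ (r - 3) = t `^ (p - 3) * t `^ (r - p))%R.
    by rewrite -powRD; [congr (_ `^ _)%R; lra|rewrite (gt_eqF t_gt0) implybT].
  have y0 := powR_ge0 t (p - 3).
  suff : (0 <= (ar - ap * t `^ (r - p)) * (h t - c * expR (- t)))%R.
    move=> h1; have := mulr_ge0 y0 h1; lra.
  have [tt|tt] := leP t t0.
    apply: mulr_ge0; rewrite subr_ge0.
      rewrite mulrC -ler_pdivlMr// -t0E; apply: ge0_ler_powR; rewrite ?nnegrE ?(ltW rp) ?(ltW t_gt0) ?(ltW t00)//.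
    have := @decay t t0; rewrite (ltW t_gt0) tt => /(_ isT) d.
    have := ler_wpM2l (expR_ge0 (t0 - t)%R) d.
    by rewrite mulrA -expRD addrA subrK subrr expR0 mul1r /c mulrAC -expRD.
  apply: mulr_le0; rewrite subr_le0.
    rewrite [leRHS]mulrC -ler_pdivrMr// -t0E; apply: ge0_ler_powR; rewrite ?nnegrE ?(ltW rp) ?(ltW t_gt0) ?(ltW t00)//.
    exact: ltW.
  have := @decay t0 t; rewrite (ltW t00) (ltW tt) => /(_ isT) d.
  by rewrite /c mulrAC -expRD.
exact: (lee_cross e2 kp0 kr0 Ep Er cross).
Qed.

(** For p < 2 the comparison passes through the moment of order 2. At p = 1 the constant of [k2] is
    infinite, so that comparison is a hypothesis; the tail inequality at t = 0 supplies it. *)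
Lemma moment_le p r : (1 <= p)%R -> (Num.max 2 p <= r)%R ->
  (p = 1%R -> wmoment w v 2 <= 2%:E * wmoment w v 1) ->
  (eg p)%:E * wmoment w v r <= (eg r)%:E * wmoment w v p.
Proof.
rewrite ge_max => p1 /andP[r2 pr] H1.
have [p0 r0] : (0 < p)%R /\ (0 < r)%R by split; lra.
have e2 := eg_gt0 (ltr0n R 2).
have Hr : (eg 2)%:E * wmoment w v r <= (eg r)%:E * wmoment w v 2.
  by move: r2; rewrite le_eqVlt => /predU1P[<-//|]; exact: moment_le_2r.
have [p2|p2|p2] := ltgtP p 2%R; last by rewrite p2.
- have Hp : (eg p)%:E * wmoment w v 2 <= (eg 2)%:E * wmoment w v p.
    move: p1; rewrite le_eqVlt => /predU1P[p1|p1]; last by apply: moment_le_p2; rewrite p1.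
    rewrite -p1; apply: (@le_trans _ _ ((eg 1)%:E * (2%:E * wmoment w v 1))).
      by apply: lee_wpmul2l; [rewrite lee_fin ltW// eg_gt0|exact: H1].
    rewrite muleA -EFinM; apply: lee_wpmul2r; first exact: wmoment_ge0.
    by rewrite lee_fin mulrC eg_1_2.
  by apply: lee_chain Hr Hp => //; exact/ltW/eg_gt0.
- by move: pr; rewrite le_eqVlt => /predU1P[->//|]; exact: moment_le_pr.
Qed.

End decay.

End comparison.

(** * The inequality *)

Section intervals.
Context {R : realType}.
Notation mu := (@lebesgue_measure R).
Local Open Scope ereal_scope.

Lemma itv_ends (J : set R) : is_interval J -> 0 < mu J -> mu J < +oo ->
  exists a b (b0 b1 : bool),
    (a < b)%R /\ J = [set` Interval (BSide b0 a) (BSide b1 b)].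
Proof.
move=> /is_intervalP ->; rewrite lebesgue_measure_itv.
case: (Rhull J) => [[b0 a|[]] [b1 b|[]]] //=; rewrite ?ltxx ?ltry ?ltNyr//=.
case: ifPn => [ab _ _|]; last by rewrite ltxx.
by exists a, b, b0, b1; rewrite -lte_fin.
Qed.

Lemma bounded_lty (J : set R) : is_interval J -> bounded_set J -> mu J < +oo.
Proof.
move=> J_itv [M [_ HM]].
have mJ : measurable J by rewrite (is_intervalP J).1//; exact: measurable_itv.
have HJ x : J x -> (`|x| <= M + 1)%R by apply: HM; rewrite ltrDl.
apply: (@le_lt_trans _ _ (mu `[(- (M + 1))%R, (M + 1)%R])).
  apply: le_measure; rewrite ?inE/=; [exact: mJ|exact: measurable_itv|].
  by move=> x /HJ; rewrite /= in_itv/= ler_norml.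
by rewrite lebesgue_measure_itv/=; case: ifPn => _; rewrite -?EFinD ltry.
Qed.

Lemma sub_itv_ends (a b c d : R) (b0 b1 b2 b3 : bool) : (c < d)%R ->
  [set` Interval (BSide b2 c) (BSide b3 d)] `<=` [set` Interval (BSide b0 a) (BSide b1 b)] ->
  (a <= c)%R /\ (d <= b)%R.
Proof.
move=> cd sub; have inI x : (c < x < d)%R -> (a <= x <= b)%R.
  move=> /andP[cx xd]; have : [set` Interval (BSide b2 c) (BSide b3 d)] x.
    by rewrite /= itv_boundlr; apply/andP; split; case: (b2); case: (b3); rewrite bnd_simp// ltW.
  move=> /sub/=; rewrite itv_boundlr => /andP[h1 h2]; apply/andP; split.
    by move: h1; case: (b0); rewrite bnd_simp// => /ltW.
  by move: h2; case: (b1); rewrite bnd_simp// => /ltW.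
split; rewrite leNgt; apply/negP => h.
  have [ad|da] := leP a d.
    have /andP[] : (a <= (c + a) / 2 <= b)%R by apply: inI; apply/andP; split; lra.
    lra.
  have /andP[] : (a <= (c + d) / 2 <= b)%R by apply: inI; apply/andP; split; lra.
  lra.
have [ad|da] := leP c b.
  have /andP[] : (a <= (b + d) / 2 <= b)%R by apply: inI; apply/andP; split; lra.
  lra.
have /andP[] : (a <= (c + d) / 2 <= b)%R by apply: inI; apply/andP; split; lra.
lra.
Qed.

Lemma average_itv (c d : R) (b0 b1 : bool) (f : R -> R) : (c < d)%R ->
  measurable_fun `]c, d[ f ->
  average [set` Interval (BSide b0 c) (BSide b1 d)] f =
  ((d - c)^-1)%:E * \int[mu]_(x in `]c, d[) (f x)%:E.
Proof.
move=> cd mf; rewrite /average lebesgue_measure_itv/= lte_fin cd -EFinD/=.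
by rewrite integral_itv_bndoo//; exact/measurable_EFinP.
Qed.

End intervals.

Section norms.
Context {R : realType}.
Notation mu := (@lebesgue_measure R).
Local Open Scope ereal_scope.
Implicit Types (a b p r s : R) (phi : R -> R).

Lemma Gamma_eg s : (0 < s)%R -> Gamma (s + 1) = eg s.
Proof.
move=> s0.
have E : \int[mu]_(x in `]0%R, +oo[) (x `^ (s + 1 - 1) * expR (- x))%:E = egamma s.
  rewrite integral_mkcond; apply: eq_integral => x _; rewrite patchE.
  have [x0|x0] := ltP 0%R x.
    by rewrite mem_set/= ?in_itv/= ?x0// expwE// /posp max_r ?(ltW x0)// addrK mulrC.
  by rewrite memNset/= ?in_itv/= ?andbT ?expw0 ?mul0r//; apply/negP; rewrite -leNgt.
by rewrite /Gamma /Rintegral E egE.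
Qed.

Definition pmoment a b p phi := \int[mu]_(x in `]a, b[) (`|phi x| `^ p)%:E.

Lemma pmoment_ge0 a b p phi : 0 <= pmoment a b p phi.
Proof. by apply: integral_ge0 => x _; rewrite lee_fin powR_ge0. Qed.

Lemma measurable_pmoment a b p phi : measurable_fun `]a, b[ phi ->
  measurable_fun `]a, b[ (fun x => (`|phi x| `^ p)%:E).
Proof.
move=> mphi; apply/measurable_EFinP.
apply: (measurableT_comp (measurable_powR p)).
exact: (measurableT_comp (@normr_measurable R setT)).
Qed.

Lemma Lp_norm_itv a b (b0 b1 : bool) p phi : (0 < p)%R -> measurable_fun `]a, b[ phi ->
  Lp_norm [set` Interval (BSide b0 a) (BSide b1 b)] p phi = pmoment a b p phi `^ p^-1.
Proof.
move=> p0 mphi; rewrite /Lp_norm unlock; congr (_ `^ _).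
rewrite /pmoment -(integral_itv_bndoo b0 b1); last exact: measurable_pmoment.
rewrite [RHS]integral_mkcond; apply: eq_integral => x _.
rewrite /= !patchE; case: ifPn => _; first by [].
change ((`|0 : R| `^ p)%:E = 0%:E).
by rewrite normr0 powR0// gt_eqF.
Qed.

(** The normalization by n sits inside v; the powers n ^ r and n ^ p combine to n ^ (r - p), the
    source of the BMO factor. *)
Lemma wmoment_pmoment a b s phi (n : R) : (0 < n)%R -> (0 < s)%R ->
  measurable_fun `]a, b[ phi ->
  pmoment a b s phi = (n `^ s)%:E *
    wmoment \1_(`]a, b[%classic) (fun x => `|(phi \_ `]a, b[) x| / n)%R s.
Proof.
move=> n0 s0 mphi; rewrite /pmoment /wmoment integral_mkcond -ge0_integralZl_EFin ?powR_ge0//.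
- apply: eq_integral => x _; rewrite -EFinM !patchE indicE; case: ifPn => _.
    rewrite mul1r -powRM ?divr_ge0 ?normr_ge0 ?(ltW n0)//.
    by rewrite mulrC divfK ?gt_eqF.
  by rewrite mul0r mulr0.
- by move=> x _; rewrite lee_fin mulr_ge0 ?powR_ge0// indicE.
- apply/measurable_EFinP; apply: measurable_funM => //.
  apply: (measurableT_comp (measurable_powR s)).
  apply: measurable_funM => //; apply: measurableT_comp => //.
  by apply/(measurable_restrictT _ _).1.
Qed.

End norms.

Section upper_bound.
Context {R : realType}.
Notation mu := (@lebesgue_measure R).
Local Open Scope ereal_scope.
Implicit Types (a b p r s : R) (phi : R -> R).

(** Here n is any positive bound on the oscillations, not only the norm: a function of norm 0 is
    treated with n = 1. *)
Lemma pmoment_le a b p r phi (n : R) : (a < b)%R -> (1 <= p)%R -> (Num.max 2 p <= r)%R ->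
  (0 < n)%R -> mu.-integrable `]a, b[ (EFin \o phi) ->
  \int[mu]_(x in `]a, b[) (phi x)%:E = 0 ->
  (forall c d m, (a <= c)%R -> (c < d)%R -> (d <= b)%R ->
  \int[mu]_(x in `]c, d[) (phi x)%:E = (m * (d - c))%:E ->
  \int[mu]_(x in `]c, d[) ((phi x - m) ^+ 2)%:E <= (n ^+ 2 * (d - c))%:E) ->
  (eg p)%:E * pmoment a b r phi <= (eg r * n `^ (r - p))%:E * pmoment a b p phi.
Proof.
move=> ab p1 r2 n0 iphi phi0 Hvar.
have [p0 r0] : (0 < p)%R /\ (0 < r)%R by move: r2; rewrite ge_max => /andP[? ?]; split; lra.
have mphi : measurable_fun `]a, b[ phi by apply/measurable_EFinP; exact: measurable_int iphi.
pose psi x := (phi x / n)%R.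
have nV0 : (0 < n^-1)%R by rewrite invr_gt0.
have EpsiZ c d : mu.-integrable `]c, d[ (EFin \o phi) ->
    mu.-integrable `]c, d[ (EFin \o psi) /\
    \int[mu]_(x in `]c, d[) (psi x)%:E = n^-1%:E * \int[mu]_(x in `]c, d[) (phi x)%:E.
  move=> i; split.
    rewrite (_ : _ \o _ = fun x => n^-1%:E * (EFin \o phi) x); first exact: integrableZl.
    by apply/funext => x /=; rewrite -EFinM mulrC.
  rewrite -integralZl//; apply: eq_integral => x _.
  by rewrite -EFinM mulrC.
have [ipsi Epsi] := EpsiZ a b iphi.
have psi0 : \int[mu]_(x in `]a, b[) (psi x)%:E = 0 by rewrite Epsi phi0 mule0.
have mpsi : measurable_fun `]a, b[ psi by exact: measurable_funM.
have varpsi c d m : (a <= c)%R -> (c < d)%R -> (d <= b)%R ->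
    \int[mu]_(x in `]c, d[) (psi x)%:E = (m * (d - c))%:E ->
    \int[mu]_(x in `]c, d[) ((psi x - m) ^+ 2)%:E <= (d - c)%:E.
  move=> ac cd db.
  have sub : `]c, d[%classic `<=` `]a, b[%classic by apply: subset_itvSoo; rewrite bnd_simp.
  have iphi' : mu.-integrable `]c, d[ (EFin \o phi) by exact: integrableS iphi.
  have mphi' : measurable_fun `]c, d[ phi by exact: measurable_funS mphi.
  have [ipsi' ->] := EpsiZ c d iphi'.
  move=> /(congr1 (fun z => n%:E * z)); rewrite muleA -!EFinM divff ?gt_eqF// mul1e mulrA.
  move=> /(Hvar c d (n * m)%R ac cd db) H.
  have n20 : (0 < n ^+ 2)%R by rewrite exprn_gt0.
  have : (n ^+ 2)%:E * \int[mu]_(x in `]c, d[) ((psi x - m) ^+ 2)%:E <= (n ^+ 2)%:E * (d - c)%:E.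
    rewrite -ge0_integralZl_EFin ?(ltW n20)//.
    - rewrite -EFinM; apply: le_trans H; rewrite le_eqVlt; apply/orP; left; apply/eqP.
      apply: eq_integral => x _; rewrite -EFinM -exprMn mulrBr /psi mulrCA divff ?gt_eqF//.
      by rewrite mulr1.
    - by move=> x _; rewrite lee_fin sqr_ge0.
    - apply/measurable_EFinP/measurable_funX/measurable_funB => //.
      exact: measurable_funM.
  by rewrite lee_pmul2l// lte_fin.
set w := (\1_(`]a, b[%classic) : R -> R).
pose v x := (`|(phi \_ `]a, b[) x| / n)%R.
have wv : nonneg_pair w v.
  split.
  - exact: measurable_indic.
  - apply: measurable_funM => //; apply: measurableT_comp => //.
    by apply/(measurable_restrictT _ _).1.
  - by move=> x; rewrite /w indicE.
  - by move=> x; rewrite /v divr_ge0// ltW.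
have wE (f : R -> R -> R) t : \int[mu]_x (w x * f (v x) t)%:E =
    \int[mu]_(x in `]a, b[) (f `|psi x| t)%:E.
  rewrite [RHS]integral_mkcond; apply: eq_integral => x _.
  rewrite patchE /w indicE /v patchE; case: ifPn => _; last by rewrite mul0r.
  by rewrite mul1r /psi normrM (gtr0_norm nV0).
have var2 : \int[mu]_(x in `]a, b[) ((psi x) ^+ 2)%:E <= (b - a)%:E.
  have := varpsi a b 0%R (lexx a) ab (lexx b); rewrite psi0 mul0r => /(_ erefl).
  by under eq_integral do rewrite subr0.
have mabs : measurable_fun `]a, b[ (fun x => `|psi x|%R) by exact: measurableT_comp.
have fin2 : \int[mu]_(x in `]a, b[) ((Num.max 0 `|psi x|) ^+ 2)%:E < +oo.
  under eq_integral do rewrite max_r// real_normK ?num_real//.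
  by apply: le_lt_trans var2 _; rewrite ltry.
have tail := tail_sqr_le ab ipsi psi0 varpsi.
have W2fin : wmoment w v 2 < +oo.
  apply: le_lt_trans fin2; rewrite le_eqVlt; apply/orP; left; apply/eqP.
  have := wE (fun y _ => (Num.max 0 y) ^+ 2)%R 0%R; rewrite /= => <-.
  apply: eq_integral => x _; rewrite powR_mulrn; last by have [] := wv.
  by rewrite max_r//; have [] := wv.
have [h Hh] := has_tail_exists wv W2fin.
have decay t s : (0 <= t <= s)%R -> (h s <= expR (t - s) * h t)%R.
  move=> ts; have /andP[t0 st] := ts; have s0 := le_trans t0 st.
  rewrite -lee_fin EFinM -!(Hh.2 _)// !wE.
  exact: (tail_decay (measurable_itv _) mabs fin2 tail).
have H := moment_le wv Hh decay p1 r2.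
rewrite (wmoment_pmoment n0 r0 mphi) (wmoment_pmoment n0 p0 mphi) -/w -/v.
have {}H : (eg p)%:E * wmoment w v r <= (eg r)%:E * wmoment w v p.
  (* The comparison demanded for p = 1 is the tail inequality at t = 0. *)
  apply: H => _; have [_ _ w0 v0] := wv.
  have vK x : Num.max 0%R (v x - 0)%R = v x by rewrite subr0 max_r.
  have -> : wmoment w v 2 = \int[mu]_(x in `]a, b[) ((Num.max 0 (`|psi x| - 0)) ^+ 2)%:E.
    rewrite -(wE (fun y t => (Num.max 0 (y - t)) ^+ 2)%R 0%R).
    by apply: eq_integral => x _; rewrite vK powR_mulrn.
  have -> : 2%:E * wmoment w v 1 = \int[mu]_(x in `]a, b[) (2 * Num.max 0 (`|psi x| - 0))%:E.
    rewrite -(wE (fun y t => 2 * Num.max 0 (y - t))%R 0%R) /wmoment.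
    rewrite -ge0_integralZl_EFin//.
    - by apply: eq_integral => x _; rewrite vK powRr1// -EFinM mulrCA.
    - by move=> x _; rewrite lee_fin mulr_ge0 ?powR_ge0.
    - apply/measurable_EFinP; apply: measurable_funM; first by have [] := wv.
      by apply: (measurableT_comp (measurable_powR 1)); have [] := wv.
  exact: tail.
rewrite muleCA [leRHS]muleA -EFinM -mulrA -powRD; last first.
  by rewrite (gt_eqF n0) implybT.
rewrite subrK mulrC EFinM -muleA.
by apply: lee_wpmul2l H; rewrite lee_fin powR_ge0.
Qed.

End upper_bound.

Section main_inequality.
Context {R : realType}.
Notation mu := (@lebesgue_measure R).
Local Open Scope ereal_scope.
Implicit Types (a b p r s : R) (phi : R -> R).

Lemma bmo_norm_variance a b (b0 b1 : bool) phi : (a < b)%R ->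
  measurable_fun `]a, b[ phi ->
  bmo_norm [set` Interval (BSide b0 a) (BSide b1 b)] phi < +oo ->
  exists2 n : R, (0 <= n)%R /\
    bmo_norm [set` Interval (BSide b0 a) (BSide b1 b)] phi = n%:E &
  forall c d m, (a <= c)%R -> (c < d)%R -> (d <= b)%R ->
  \int[mu]_(x in `]c, d[) (phi x)%:E = (m * (d - c))%:E ->
  \int[mu]_(x in `]c, d[) ((phi x - m) ^+ 2)%:E <= (n ^+ 2 * (d - c))%:E.
Proof.
move=> ab mphi; rewrite /bmo_norm.
set I := [set` _]; set S := ereal_sup _ => Sfin.
have sub c d : (a <= c)%R -> (d <= b)%R -> `]c, d[%classic `<=` I.
  move=> ac db x /=; rewrite /I/= in_itv/= itv_boundlr => /andP[cx xd].
  apply/andP; split; [case: (b0)|case: (b1)]; rewrite bnd_simp.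
  - exact/ltW/(le_lt_trans ac).
  - exact: le_lt_trans cx.
  - exact: lt_le_trans db.
  - exact/ltW/(lt_le_trans xd).
have avg c d : (a <= c)%R -> (c < d)%R -> (d <= b)%R ->
    average `]c, d[ (fun x => `|phi x - fine (average `]c, d[ phi)| ^+ 2)%R <= S.
  move=> ac cd db; apply: ereal_sup_ubound; exists `]c, d[%classic => //; split.
  - exact: interval_is_interval.
  - exact: sub.
  - by rewrite lebesgue_measure_itv/= lte_fin cd -EFinD lte_fin subr_gt0.
have mphi' c d : (a <= c)%R -> (d <= b)%R -> measurable_fun `]c, d[ phi.
  by move=> ac db; apply: measurable_funS mphi => //; apply: subset_itvSoo; rewrite bnd_simp.
have m2 c d m : (a <= c)%R -> (d <= b)%R -> measurable_fun `]c, d[ (fun x => `|phi x - m| ^+ 2)%R.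
  move=> ac db; apply: measurable_funX; apply: measurableT_comp => //.
  by apply: measurable_funB => //; exact: mphi'.
have S0 : 0 <= S.
  apply: le_trans (avg a b (lexx _) ab (lexx _)).
  rewrite (@average_itv _ _ _ false true)//; last exact: m2.
  rewrite mule_ge0 ?lee_fin ?invr_ge0 ?subr_ge0 ?(ltW ab)//.
  by apply: integral_ge0 => x _; rewrite lee_fin sqr_ge0.
have Nfin : sqrte S \is a fin_num by rewrite ge0_fin_numE// sqrte_ge0.
have NE : sqrte S = (fine (sqrte S))%:E by rewrite fineK.
exists (fine (sqrte S)); first by split => //; exact/fine_ge0/sqrte_ge0.
move=> c d m ac cd db Em.
have dc : (0 < d - c)%R by rewrite subr_gt0.
have Ea : average `]c, d[ phi = m%:E.
  rewrite (@average_itv _ _ _ false true)//; last exact: mphi'.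
  by rewrite Em -EFinM mulrCA mulVf ?mulr1// gt_eqF.
have := avg c d ac cd db; rewrite Ea/= (@average_itv _ _ _ false true)//; last exact: m2.
under eq_integral do rewrite real_normK ?num_real//.
have ES : S = (fine (sqrte S) ^+ 2)%:E by rewrite -[LHS]sqr_sqrte// {1}NE -EFin_expe.
rewrite lee_pdivrMl// => H; rewrite ES in H; apply: le_trans H _.
by rewrite -EFinM mulrC.
Qed.

Lemma multiplicative_inequality a b (b0 b1 : bool) p r phi : (a < b)%R ->
  (1 <= p)%R -> (Num.max 2 p <= r)%R ->
  let I := [set` Interval (BSide b0 a) (BSide b1 b)] in
  bmo I phi -> average I phi = 0%E ->
  Lp_norm I r phi <=
    ((eg r / eg p) `^ r^-1)%:E * Lp_norm I p phi `^ (p / r) * bmo_norm I phi `^ (1 - p / r).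
Proof.
move=> ab p1 r2 I [iI Nfin] avg0.
have [p0 r0] : (0 < p)%R /\ (0 < r)%R by move: r2; rewrite ge_max => /andP[? ?]; split; lra.
have pr : (p <= r)%R by move: r2; rewrite ge_max => /andP[].
have iphi : mu.-integrable `]a, b[ (EFin \o phi).
  apply: integrableS iI => //; first exact: measurable_itv.
  move=> x; rewrite /I/= in_itv/= itv_boundlr => /andP[ax xb].
  by apply/andP; split; [case: (b0)|case: (b1)]; rewrite bnd_simp// ltW.
have mphi : measurable_fun `]a, b[ phi by apply/measurable_EFinP; exact: measurable_int iphi.
have phi0 : \int[mu]_(x in `]a, b[) (phi x)%:E = 0.
  move: avg0; rewrite average_itv// => /eqP; rewrite mule_eq0 => /orP[|/eqP//].
  by rewrite eqe invr_eq0 subr_eq0 gt_eqF.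
have [n [n_ge0 EN] Hvar] := bmo_norm_variance ab mphi Nfin.
rewrite !Lp_norm_itv// EN poweR_EFin -poweRrM.
have -> : (p^-1 * (p / r) = r^-1)%R by rewrite mulrA mulVf ?mul1r// gt_eqF.
have ep := eg_gt0 p0; have er := eg_gt0 r0.
have [ep_ge0 er_ge0] := (ltW ep, ltW er).
have rV0 : (0 <= r^-1)%R by rewrite invr_ge0 ltW.
have KE : (0 <= (eg r / eg p) `^ r^-1)%R by exact: powR_ge0.
(* Norm 0. If p = r, the last factor is 0 ^ 0 = 1 and the two sides coincide. Otherwise the variance
   bound annihilates the second moment, and [pmoment_le] from order 2 to order r, with n = 1,
   annihilates the left side. *)
move: n_ge0; rewrite le_eqVlt => /predU1P[n0|n0].
  move: pr; rewrite le_eqVlt => /predU1P[pr|pr].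
    rewrite -pr !divff ?gt_eqF// powR1 subrr powRr0 mule1 mul1e; exact: lexx.
  have Y2 : pmoment a b 2 phi = 0.
    apply/eqP; rewrite eq_le pmoment_ge0 andbT.
    have := Hvar a b 0%R (lexx a) ab (lexx b); rewrite phi0 mul0r => /(_ erefl).
    rewrite -n0 expr0n/= mul0r; apply: le_trans.
    rewrite le_eqVlt; apply/orP; left; apply/eqP; apply: eq_integral => x _.
    by rewrite subr0 powR_mulrn// real_normK ?num_real.
  have r2' : (Num.max 2 2 <= r)%R by move: r2; rewrite !ge_max => /andP[->].
  have : (eg 2)%:E * pmoment a b r phi <= (eg r * 1 `^ (r - 2))%:E * pmoment a b 2 phi.
    apply: pmoment_le => //; first by rewrite ler1n.
    move=> c d m ac cd db Em; apply: le_trans (Hvar c d m ac cd db Em) _.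
    by rewrite lee_fin -n0 expr0n/= mul0r expr1n mul1r subr_ge0 ltW.
  rewrite Y2 mule0 => H.
  have -> : pmoment a b r phi = 0.
    apply/eqP; rewrite eq_le pmoment_ge0 andbT.
    by rewrite -(@lee_pmul2l _ (eg 2)%:E)// ?mule0// lte_fin eg_gt0.
  rewrite poweR0r ?invr_eq0 ?gt_eqF//.
  by rewrite !mule_ge0 ?poweR_ge0 ?lee_fin ?powR_ge0.
have H := pmoment_le ab p1 r2 n0 iphi phi0 Hvar.
have {}H : pmoment a b r phi <= (eg r / eg p * n `^ (r - p))%:E * pmoment a b p phi.
  have epV : (0 < (eg p)%:E) by rewrite lte_fin.
  rewrite -(lee_pmul2l _ epV)// muleA -EFinM mulrA mulrCA divff ?gt_eqF// mulr1.
  exact: H.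
have n_ge0 : (0 <= n `^ (r - p))%R by exact: powR_ge0.
have K0 : (0 <= eg r / eg p)%R by rewrite divr_ge0.
apply: (@le_trans _ _ (((eg r / eg p * n `^ (r - p))%:E * pmoment a b p phi) `^ r^-1)).
  apply: gt0_ler_poweR => //; rewrite in_itv/= leey andbT ?pmoment_ge0//.
  by rewrite mule_ge0 ?pmoment_ge0// lee_fin mulr_ge0.
have Kn0 : 0 <= (eg r / eg p * n `^ (r - p))%:E by rewrite lee_fin mulr_ge0.
rewrite (poweRM _ Kn0 (pmoment_ge0 a b p phi)) poweR_EFin powRM// -powRrM.
have -> : ((r - p) / r = 1 - p / r)%R by rewrite mulrBl divff// gt_eqF.
by rewrite EFinM muleAC.
Qed.

End main_inequality.

(** * Sharpness *)

Section affine_itv.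
Context {R : realType}.
Notation mu := (@lebesgue_measure R).
Local Open Scope ereal_scope.

Lemma ge0_integral_oppr (f : R -> \bar R) : measurable_fun setT f ->
  (forall x, 0 <= f x) -> \int[mu]_x f (- x)%R = \int[mu]_x f x.
Proof.
move=> mf f0.
pose T : R -> measurableTypeR R := fun x => (- x)%R.
have mN : measurable_fun setT T by apply: measurable_funN.
pose m1 := measure_function_pushforward__canonical__measure_function_Measure mu mN.
rewrite [in RHS](eq_measure_integral m1) => [|A mA _].
  by rewrite ge0_integral_pushforward.
exact/esym/lebesgue_measureN.
Qed.

Lemma integral_affine_itv (f : R -> R) (l a c d : R) : (0 < l)%R ->
  measurable_fun setT f -> (forall y, 0 <= f y)%R ->
  \int[mu]_(x in `]c, d[) (f ((x - a) / l))%:E =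
  l%:E * \int[mu]_(y in `]((c - a) / l)%R, ((d - a) / l)%R[) (f y)%:E.
Proof.
move=> l0 mf f0; set I := `]((c - a) / l)%R, ((d - a) / l)%R[%classic.
have mI : measurable_fun setT (fun y => (EFin \o f) \_ I y).
  by apply/(measurable_restrictT _ _).1; [exact: measurable_itv|exact/measurable_EFinP/measurable_funTS].
have pI y : 0 <= ((EFin \o f) \_ I) y by apply: erestrict_ge0 => z _; rewrite lee_fin.
rewrite [in RHS]integral_mkcond.
have lV : (0 < l^-1)%R by rewrite invr_gt0.
have := ge0_integral_affine (- a / l)%R lV mI pI; rewrite invrK => <-.
rewrite integral_mkcond; apply: eq_integral => x _.
have -> : (l^-1 * x + - a / l = (x - a) / l)%R by rewrite mulrC -mulrDl.
rewrite !patchE; congr (if _ then _ else _).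
by apply/idP/idP; rewrite /I !inE/= !in_itv/= !ltr_pM2r// !ltrD2r.
Qed.

Lemma integral_reflect_itv (f : R -> R) (l b c d : R) : (0 < l)%R ->
  measurable_fun setT f -> (forall y, 0 <= f y)%R ->
  \int[mu]_(x in `]c, d[) (f ((b - x) / l))%:E =
  l%:E * \int[mu]_(y in `]((b - d) / l)%R, ((b - c) / l)%R[) (f y)%:E.
Proof.
move=> l0 mf f0.
have := @integral_affine_itv f l (- b) (- d) (- c) l0 mf f0.
rewrite ![(- _ - - b)%R]addrC !opprK => <-.
rewrite [LHS]integral_mkcond [RHS]integral_mkcond.
rewrite -[RHS]ge0_integral_oppr.
- apply: eq_integral => x _; rewrite !patchE [(- x + b)%R]addrC.
  congr (if _ then _ else _).
  by apply/idP/idP; rewrite !inE/= !in_itv/= !ltrN2 andbC.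
- apply/(measurable_restrictT _ _).1; first exact: measurable_itv.
  apply/measurable_EFinP/measurable_funTS; apply: measurableT_comp => //.
  by apply: measurable_funM => //; exact: measurable_funD.
- by move=> y; apply: erestrict_ge0 => z _; rewrite lee_fin.
Qed.

End affine_itv.

(** * The logarithmic profile *)

Section log_profile.
Context {R : realType}.
Notation mu := (@lebesgue_measure R).
Local Open Scope ereal_scope.
Implicit Types (x y z s t : R).

(** As [ln] is 0 at nonpositive reals, this is ln (1 / y) on ]0, 1[ and 0 elsewhere on the whole
    line. *)
Definition V y : R := Num.max 0%R (- ln y)%R.

Lemma V_ge0 y : (0 <= V y)%R. Proof. by rewrite /V le_max lexx. Qed.

Lemma measurable_V : measurable_fun setT V.
Proof.
apply: measurable_maxr => //; apply: measurableT_comp => //; exact: measurable_ln.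
Qed.

Lemma V_out y : (y <= 0)%R || (1 <= y)%R -> V y = 0%R.
Proof.
rewrite /V => /orP[y0|y1]; first by rewrite ln0// oppr0 maxxx.
by apply/max_idPl; rewrite oppr_le0 ln_ge0.
Qed.

Lemma V_in y : (0 < y <= 1)%R -> V y = (- ln y)%R.
Proof. by move=> /andP[y0 y1]; rewrite /V max_r// oppr_ge0 ln_le0. Qed.

(* On ]0, 1[ the logarithmic profile is distributed as an exponential variable;
   dilations play the role of memorylessness. *)
Lemma V_tail t y : (0 <= t)%R -> Num.max 0%R (V y - t)%R = V (expR t * y).
Proof.
move=> t0; have [y0|y0] := ltP 0%R y; last first.
  rewrite !V_out ?y0//; first by rewrite sub0r; apply/max_idPl; lra.
  by rewrite pmulr_rle0 ?expR_gt0// y0.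
rewrite /V lnM ?posrE ?expR_gt0// expRK opprD.
by case: (leP (- ln y)%R 0%R) => h; case: (leP (- t - ln y)%R 0%R) => h1;
  case: (leP _ 0%R) => h2; lra.
Qed.

Let ln_der z : (0 < z)%R -> is_derive z 1%R (@ln R) z^-1%R.
Proof. exact: is_derive1_ln. Qed.

Let integral_oc (f : R -> R) (c d : R) : measurable_fun setT f ->
  \int[mu]_(y in `]c, d]) (f y)%:E = \int[mu]_(y in `]c, d[) (f y)%:E.
Proof.
by move=> mf; rewrite (integral_itv_bndoo false false)//; exact/measurable_EFinP/measurable_funTS.
Qed.

(** ln d - 1 is the mean of ln over ]0, d], and it is kept for every c. The primitive y * ((ln y -
    ln d) ^ 2 + 1) equals d at d and is at least z at every z in ]c, d[; at c = 0 the variance is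
    exactly that of the exponential distribution. *)
Lemma log_oscillation (c d : R) : (0 <= c)%R -> (c < d)%R ->
  \int[mu]_(y in `]c, d]) ((ln y - ln d + 1) ^+ 2)%:E <= (d - c)%:E.
Proof.
move=> c0 cd; have d0 : (0 < d)%R by exact: le_lt_trans cd.
apply: (@ge0_integral_oc_le _ _ (fun y => y * ((ln y - ln d) ^+ 2 + 1))%R) => //.
- move=> z cz; have z0 : (0 < z)%R by exact: le_lt_trans cz.
  have dz := ln_der z0.
  apply: is_derive_eq.
  rewrite /GRing.scale/=; set L := ln z; set D := ln d.
  have : (z * z^-1 = 1)%R by rewrite divff// gt_eqF.
  move: (z^-1)%R => zV h.
  transitivity (2 * (L - D) * (z * zV) + (L - D) ^+ 2 + 1)%R; first by lra.
  by rewrite h; lra.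
- move=> z cz; have z0 : (0 < z)%R by exact: le_lt_trans cz.
  have dz := ln_der z0.
  by apply: differentiable_continuous; apply/derivable1_diffP.
- by move=> z _; exact: sqr_ge0.
- move=> z /andP[cz zd]; have z0 : (0 < z)%R by exact: le_lt_trans cz.
  rewrite subrr expr0n/= add0r mulr1.
  have : (0 <= z * (ln z - ln d) ^+ 2)%R by rewrite mulr_ge0 ?sqr_ge0// ltW.
  lra.
Qed.

(** The primitive y * ((ln y) ^ 2 - 2 ln y + 2) is 2 at 1 and at least 2 z at z in ]c, 1[. The form
    2 - c is the one that adds up in [two_logs_oscillation]. *)
Lemma log_square (c : R) : (0 <= c <= 1)%R ->
  \int[mu]_(y in `]c, 1%R]) ((ln y) ^+ 2)%:E <= (2 - c)%:E.
Proof.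
move=> /andP[c0]; rewrite le_eqVlt => /predU1P[->|c1].
  by rewrite set_itvoc0 integral_set0 lee_fin; lra.
apply: (@ge0_integral_oc_le _ _ (fun y => y * ((ln y) ^+ 2 - 2 * ln y + 2))%R) => //.
- move=> z cz; have z0 : (0 < z)%R by exact: le_lt_trans cz.
  have dz := ln_der z0.
  apply: is_derive_eq.
  rewrite /GRing.scale/=; set L := ln z.
  have : (z * z^-1 = 1)%R by rewrite divff// gt_eqF.
  move: (z^-1)%R => zV h.
  transitivity ((2 * L - 2) * (z * zV) + L ^+ 2 - 2 * L + 2)%R; first by lra.
  by rewrite h; lra.
- move=> z cz; have z0 : (0 < z)%R by exact: le_lt_trans cz.
  have dz := ln_der z0.
  by apply: differentiable_continuous; apply/derivable1_diffP.
- by move=> z _; exact: sqr_ge0.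
- move=> z /andP[cz z1]; have z0 : (0 < z)%R by exact: le_lt_trans cz.
  rewrite ln1 expr0n/= mulr0 subr0 add0r mul1r.
  have l0 : (ln z <= 0)%R by rewrite ln_le0// ltW.
  have : (0 <= z * ((ln z) ^+ 2 - 2 * ln z))%R.
    by rewrite mulr_ge0 ?(ltW z0)// addr_ge0 ?sqr_ge0//; lra.
  lra.
Qed.

(** For d <= 1 this is [log_oscillation]. For d > 1 the comparison value is 1: the logarithmic part
    contributes at most its length, and on the flat part (V - 1) ^ 2 is 1, so the integral there
    equals the length. *)
Lemma V_oscillation (c d : R) : (0 <= c)%R -> (c < d)%R ->
  \int[mu]_(y in `]c, d[) ((V y - (1 + V d)) ^+ 2)%:E <= (d - c)%:E.
Proof.
move=> c0 cd; have d0 : (0 < d)%R by exact: le_lt_trans cd.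
have mV := measurable_V.
have mVm m : measurable_fun setT (fun y => (V y - m) ^+ 2)%R.
  by apply: measurable_funX; exact: measurable_funB.
have [d1|d1] := leP d 1%R.
  rewrite -integral_oc//; apply: le_trans (log_oscillation c0 cd).
  rewrite le_eqVlt; apply/orP; left; apply/eqP; apply: eq_integral => y.
  rewrite inE/= in_itv/= => /andP[cy yd]; congr EFin.
  rewrite !V_in ?d0// ?(le_lt_trans c0 cy) ?(le_trans yd)//.
  lra.
rewrite [V d]V_out ?(ltW d1) ?orbT// addr0.
have tail_one (e : R) : (1 <= e <= d)%R -> \int[mu]_(y in `]e, d[) ((V y - 1) ^+ 2)%:E = (d - e)%:E.
  move=> /andP[e1 ed]; transitivity (\int[mu]_(y in `]e, d[) (1 : R)%:E).
    apply: eq_integral => y; rewrite inE/= in_itv/= => /andP[ey _]; congr EFin.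
    by rewrite V_out ?sub0r ?sqrrN ?expr1n// (le_trans e1 (ltW ey)) orbT.
  by rewrite integral_cst_itvoo// mul1r.
have [c1|c1] := leP 1%R c; first by rewrite tail_one// c1 ltW.
have -> : `]c, d[%classic = `]c, 1%R] `|` `]1%R, d[ :> set R.
  by rewrite -itv_bndbnd_setU// bnd_simp// ltW.
rewrite ge0_integral_setU//=.
- rewrite tail_one ?lexx ?(ltW d1)//.
  have := log_oscillation c0 c1; rewrite ln1.
  have -> : \int[mu]_(y in `]c, 1%R]) ((ln y - 0 + 1) ^+ 2)%:E =
    \int[mu]_(y in `]c, 1%R]) ((V y - 1) ^+ 2)%:E.
    apply: eq_integral => y; rewrite inE/= in_itv/= => /andP[cy y1]; congr EFin.
    by rewrite V_in ?(le_lt_trans c0 cy)//; lra.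
  move=> H; apply: le_trans (leeD H (lexx _)) _.
  by rewrite -EFinD lee_fin; lra.
- by apply/measurable_EFinP/measurable_funTS; exact: mVm.
- by move=> x _; rewrite lee_fin sqr_ge0.
- apply/disj_setPS => y [] /=; rewrite !in_itv/= => /andP[_ y1] /andP[y1' _].
  by move: (lt_le_trans y1' y1); rewrite ltxx.
Qed.

Lemma V_square (c d : R) : (0 <= c <= 1)%R ->
  \int[mu]_(y in `]c, d[) ((V y) ^+ 2)%:E <= (2 - c)%:E.
Proof.
move=> c01; have /andP[c0 c1] := c01; apply: le_trans (log_square c01).
have mV2 : measurable_fun setT (fun y => (V y) ^+ 2)%R.
  by apply: measurable_funX; exact: measurable_V.
have -> : \int[mu]_(y in `]c, 1%R]) ((ln y) ^+ 2)%:E =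
    \int[mu]_(y in `]c, 1%R]) ((V y) ^+ 2)%:E.
  apply: eq_integral => y; rewrite inE/= in_itv/= => /andP[cy y1].
  by rewrite V_in ?(le_lt_trans c0 cy)// sqrrN.
rewrite integral_mkcond [leRHS]integral_mkcond.
apply: ge0_le_integral => //.
- by move=> y _; apply: erestrict_ge0 => z _; rewrite lee_fin sqr_ge0.
- by apply/(measurable_restrictT _ _).1 => //; exact/measurable_EFinP/measurable_funTS.
- by apply/(measurable_restrictT _ _).1 => //; exact/measurable_EFinP/measurable_funTS.
move=> y _; rewrite !patchE; case: ifPn => [|_]; last first.
  by case: ifPn => _ //; rewrite lee_fin sqr_ge0.
rewrite inE/= in_itv/= => /andP[cy _].
have [y1|y1] := leP y 1%R; first by rewrite mem_set//= in_itv/= cy.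
by rewrite V_out ?(ltW y1) ?orbT// expr0n/=; case: ifPn.
Qed.

Lemma nonneg_pair_V : nonneg_pair (cst 1%R) V.
Proof. by split => //; [exact: measurable_V|exact: V_ge0]. Qed.

(** Dilating by expR t multiplies integrals over the line by expR (- t), so by [V_tail] both tails
    are exactly exponential. The constant c stays abstract: it cancels in the ratio of two
    moments. *)
Lemma V_moments : exists2 c : R, (0 < c)%R &
  forall s, (1 <= s)%R -> \int[mu]_y (V y `^ s)%:E = (c * eg s)%:E.
Proof.
have mV := measurable_V.
have scale (g : R -> R) t : measurable_fun setT g -> (forall y, 0 <= g (V y))%R ->
    \int[mu]_y (g (V (expR t * y)))%:E = (expR (- t))%:E * \int[mu]_y (g (V y))%:E.
  move=> mg g0; rewrite expRN -(@ge0_integral_affine R (expR t) 0 (fun y => (g (V y))%:E)) ?expR_gt0//.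
  - by under [RHS]eq_integral do rewrite addr0.
  by apply/measurable_EFinP; exact: measurableT_comp.
have V2fin : \int[mu]_y ((V y) ^+ 2)%:E < +oo.
  have := @V_square 0 1; rewrite lexx ler01 => /(_ isT) H; apply: le_lt_trans (ltry (2 - 0)).
  apply: le_trans H; rewrite [leRHS]integral_mkcond; apply: ge0_le_integral => //.
  - by move=> y _; rewrite lee_fin sqr_ge0.
  - by apply/measurable_EFinP; exact: measurable_funX.
  - apply/(measurable_restrictT _ _).1; first exact: measurable_itv.
    by apply/measurable_EFinP/measurable_funTS; exact: measurable_funX.
  move=> y _; rewrite patchE; case: ifPn => //.
  rewrite notin_setE/= in_itv/= => /negP; rewrite negb_and -!leNgt => y01.
  by rewrite V_out// expr0n.
have V1fin : \int[mu]_y (V y)%:E < +oo.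
  apply: (@le_lt_trans _ _ (\int[mu]_y ((\1_(`]0%R, 1%R[%classic) y)%:E + ((V y) ^+ 2)%:E))).
    apply: ge0_le_integral => //.
    - by move=> y _; rewrite lee_fin V_ge0.
    - exact/measurable_EFinP.
    - apply: emeasurable_funD; apply/measurable_EFinP; last exact: measurable_funX.
      exact: measurable_indic.
    move=> y _; rewrite -EFinD lee_fin indicE; case: (boolP (_ \in _)) => [_|].
      by change (V y <= 1 + V y ^+ 2)%R; have := V_ge0 y; nra.
    rewrite notin_setE/= in_itv/= => /negP; rewrite negb_and -!leNgt => y01.
    by rewrite V_out// expr0n/= add0r.
  rewrite ge0_integralD//.
  - apply: lte_add_pinfty => //.
    have -> : \int[mu]_y (\1_(`]0%R, 1%R[%classic) y)%:E = \int[mu]_(y in `]0%R, 1%R[) (1 : R)%:E.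
      rewrite [RHS]integral_mkcond; apply: eq_integral => y _.
      by rewrite indicE patchE; case: ifPn.
    by rewrite integral_cst_itvoo// ltry.
  - by apply/measurable_EFinP; exact: measurable_indic.
  - by move=> y _; rewrite lee_fin sqr_ge0.
  - by apply/measurable_EFinP; exact: measurable_funX.
have V1gt0 : 0 < \int[mu]_y (V y)%:E.
  apply: (@integral_gt0_itv _ _ 0%R (expR (- 1)) 1%R) => //.
    exact: V_ge0.
  move=> y /andP[y0 y1]; have y1' : (y <= 1)%R.
    by apply: le_trans (ltW y1) _; rewrite expR_le1; lra.
  rewrite V_in ?y0// lerNr -[leRHS](expRK (- 1)%R) ler_ln ?posrE ?expR_gt0//.
  exact: ltW.
have E1 : \int[mu]_y (V y)%:E = (fine (\int[mu]_y (V y)%:E))%:E.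
  by rewrite fineK// ge0_fin_numE// integral_ge0// => y _; rewrite lee_fin V_ge0.
set c1 := fine _ in E1.
have c1_gt0 : (0 < c1)%R by rewrite -lte_fin -E1.
have E2 : \int[mu]_y ((V y) ^+ 2)%:E = (fine (\int[mu]_y ((V y) ^+ 2)%:E))%:E.
  by rewrite fineK// ge0_fin_numE// integral_ge0// => y _; rewrite lee_fin sqr_ge0.
set c2 := fine _ in E2.
exists (c1 / eg 1)%R; first by rewrite divr_gt0// eg_gt0.
move=> s s1; rewrite -(@exp_tail_moment _ (cst 1%R) V c1 c2)//.
- by apply: eq_integral => y _; rewrite mul1r.
- exact: nonneg_pair_V.
- move=> t t0; rewrite EFinM -E1 -(scale (fun y => y))//.
  + by apply: eq_integral => y _; rewrite mul1r /k0 V_tail.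
  + exact: V_ge0.
- split.
    apply: measurable_funM => //; apply: continuous_measurable_fun => x.
    by apply: continuous_comp; [exact: opp_continuous|exact: continuous_expR].
  move=> t t0; rewrite EFinM -E2 -(scale (fun y => y ^+ 2)%R)//.
  + by apply: eq_integral => y _; rewrite mul1r /k1 V_tail.
  + by move=> y; exact: sqr_ge0.
Qed.

End log_profile.

(** * The extremal function and the optimal constant *)

Section extremal.
Context {R : realType}.
Notation mu := (@lebesgue_measure R).
Local Open Scope ereal_scope.

(** Replacing m by the mean k lowers the integral by (m - k) ^ 2 times the length; oscillations can
    therefore be bounded with any convenient m. *)
Lemma variance_minimal (phi : R -> R) (c d k m M : R) : (c < d)%R ->
  mu.-integrable `]c, d[ (EFin \o phi) ->
  \int[mu]_(x in `]c, d[) (phi x)%:E = (k * (d - c))%:E ->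
  \int[mu]_(x in `]c, d[) ((phi x - m) ^+ 2)%:E <= M%:E ->
  \int[mu]_(x in `]c, d[) ((phi x - k) ^+ 2)%:E <= M%:E.
Proof.
move=> cd iphi Ek EM.
have mphi : measurable_fun `]c, d[ phi by apply/measurable_EFinP; exact: measurable_int iphi.
have i2 : mu.-integrable `]c, d[ (EFin \o (fun x => (phi x - m) ^+ 2)%R).
  apply/integrableP; split.
    by apply/measurable_EFinP/measurable_funX; exact: measurable_funB.
  under eq_integral => x _ do rewrite /= ger0_norm ?sqr_ge0//.
  by apply: le_lt_trans EM _; rewrite ltry.
have [i1 E1] := @integral_affine_itvoo _ _ c d (2 * (m - k)) (k ^+ 2 - m ^+ 2) _ (ltW cd) iphi Ek.
have -> : \int[mu]_(x in `]c, d[) ((phi x - k) ^+ 2)%:E =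
   \int[mu]_(x in `]c, d[) (((phi x - m) ^+ 2)%:E + (2 * (m - k) * phi x + (k ^+ 2 - m ^+ 2))%:E).
  by apply: eq_integral => x _; rewrite -EFinD; congr EFin; lra.
rewrite integralD_EFin//= E1; apply: le_trans (leeD EM (lexx _)) _.
rewrite -EFinD lee_fin.
have : (0 <= (m - k) ^+ 2 * (d - c))%R by rewrite mulr_ge0 ?sqr_ge0// subr_ge0 ltW.
lra.
Qed.

Section two_logs.
Variables a b l : R.
Hypotheses (l0 : (0 < l)%R) (lE : (b - a = 4 * l)%R).

Let ab : (a < b)%R. Proof. by move: l0 lE; lra. Qed.

(** With l a quarter of the length, the logarithms live on the outer quarters, and the middle half,
    where the function is 0, makes up for the second moments of both in an interval that meets
    both. *)
Definition two_logs (x : R) : R := (V ((x - a) / l) - V ((b - x) / l))%R.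

Let mL : measurable_fun setT (fun x : R => V ((x - a) / l)).
Proof.
apply: (measurableT_comp measurable_V).
by apply: measurable_funM => //; exact: measurable_funB.
Qed.

Let mR : measurable_fun setT (fun x : R => V ((b - x) / l)).
Proof.
apply: (measurableT_comp measurable_V).
by apply: measurable_funM => //; exact: measurable_funB.
Qed.

Lemma measurable_two_logs : measurable_fun setT two_logs.
Proof. exact: measurable_funB. Qed.

Let left0 (x : R) : (a + l <= x)%R -> V ((x - a) / l) = 0%R.
Proof. by move=> ax; rewrite V_out// ler_pdivlMr// orbC; apply/orP; left; lra. Qed.

Let right0 (x : R) : (x <= b - l)%R -> V ((b - x) / l) = 0%R.
Proof. by move=> xb; rewrite V_out// ler_pdivlMr// orbC; apply/orP; left; lra. Qed.

Let disjoint (x : R) : V ((x - a) / l) = 0%R \/ V ((b - x) / l) = 0%R.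
Proof.
have [ax|xa] := leP (a + l)%R x; first by left; exact: left0.
by right; apply: right0; move: l0 lE xa; lra.
Qed.

Let moments (c s : R) : (1 <= s)%R ->
  \int[mu]_y (V y `^ s)%:E = (c * eg s)%:E ->
  \int[mu]_(x in `]a, b[) (V ((x - a) / l) `^ s)%:E = (l * c * eg s)%:E /\
  \int[mu]_(x in `]a, b[) (V ((b - x) / l) `^ s)%:E = (l * c * eg s)%:E.
Proof.
move=> s1 Ec.
have mVs : measurable_fun setT (fun y => V y `^ s)%R.
  by apply: (measurableT_comp (measurable_powR s)); exact: measurable_V.
have Vs0 y : (0 <= V y `^ s)%R by exact: powR_ge0.
(* Both substitutions carry []a, b[] to []0, 4[], which contains the support of [V]. *)
have E4 : \int[mu]_(y in `]0%R, 4%R[) (V y `^ s)%:E = (c * eg s)%:E.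
  rewrite -Ec integral_mkcond; apply: eq_integral => y _; rewrite patchE.
  case: ifPn => //; rewrite notin_setE/= in_itv/= => /negP y04.
  rewrite V_out ?powR0 ?gt_eqF//; first by lra.
  by move: y04; rewrite negb_and -!leNgt => /orP[->//|y4]; rewrite orbC (le_trans _ y4)// ler1n.
have ba : ((b - a) / l = 4)%R by rewrite lE mulfK// gt_eqF.
rewrite (integral_affine_itv a a b l0 mVs Vs0) (integral_reflect_itv b a b l0 mVs Vs0).
by rewrite !subrr mul0r ba E4 -EFinM mulrA.
Qed.

Lemma two_logs_moments : exists2 D : R, (0 < D)%R &
  forall s, (1 <= s)%R -> pmoment a b s two_logs = (D * eg s)%:E.
Proof.
have [c c0 Hc] := @V_moments R.
exists (2 * (l * c))%R; first by rewrite !mulr_gt0//.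
move=> s s1; have [EL ER] := moments s1 (Hc s s1).
have s_neq0 : s != 0%R by rewrite gt_eqF//; lra.
transitivity (\int[mu]_(x in `]a, b[)
    ((V ((x - a) / l) `^ s)%:E + (V ((b - x) / l) `^ s)%:E)).
  apply: eq_integral => x _; rewrite -EFinD /two_logs; congr EFin.
  have [->|->] := disjoint x; rewrite powR0//.
    by rewrite sub0r normrN ger0_norm ?V_ge0// add0r.
  by rewrite subr0 ger0_norm ?V_ge0// addr0.
have ms (f : R -> R) : measurable_fun setT f ->
    measurable_fun `]a, b[ (fun x => (f x `^ s)%:E).
  move=> mf; apply/measurable_EFinP/measurable_funTS.
  exact: (measurableT_comp (measurable_powR s)).
rewrite ge0_integralD//.
- by rewrite EL ER -EFinD; congr EFin; lra.
- by move=> x _; rewrite lee_fin powR_ge0.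
- exact: (ms _ mL).
- by move=> x _; rewrite lee_fin powR_ge0.
- exact: (ms _ mR).
Qed.

Lemma integrable_two_logs (b0 b1 : bool) :
  mu.-integrable [set` Interval (BSide b0 a) (BSide b1 b)] (EFin \o two_logs).
Proof.
have mphi := measurable_two_logs.
apply/integrableP; split; first exact/measurable_EFinP/measurable_funTS.
rewrite integral_itv_bndoo; last first.
  apply/measurable_EFinP/measurable_funTS.
  exact: (measurableT_comp (@normr_measurable R setT)).
have [D _ HD] := two_logs_moments.
have := HD 1%R (lexx _); rewrite /pmoment.
under eq_integral do rewrite powRr1//.
by rewrite /= => ->; rewrite ltry.
Qed.

Lemma integral_two_logs : \int[mu]_(x in `]a, b[) (two_logs x)%:E = 0.
Proof.
have [c c0 Hc] := @V_moments R.
have [EL ER] := moments (lexx _) (Hc 1%R (lexx _)).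
have i1 (f : R -> R) : measurable_fun setT f -> (forall x, 0 <= f x)%R ->
    \int[mu]_(x in `]a, b[) (f x `^ 1)%:E = (l * c * eg 1)%:E ->
    mu.-integrable `]a, b[ (EFin \o f) /\
    \int[mu]_(x in `]a, b[) (f x)%:E = (l * c * eg 1)%:E.
  move=> mf f0; under eq_integral do rewrite powRr1//.
  move=> Ef; split => //.
  apply/integrableP; split; first exact/measurable_EFinP/measurable_funTS.
  under eq_integral do rewrite /= ger0_norm//.
  by rewrite Ef ltry.
have [iL {}EL] := i1 _ mL (fun x => V_ge0 _) EL.
have [iR {}ER] := i1 _ mR (fun x => V_ge0 _) ER.
transitivity (\int[mu]_(x in `]a, b[) ((V ((x - a) / l))%:E - (V ((b - x) / l))%:E)).
  by apply: eq_integral => x _; rewrite EFinB.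
rewrite (integralB_EFin _ iL iR); last exact: measurable_itv.
by rewrite EL ER -EFinB subrr.
Qed.

(* An interval that avoids one of the two singularities sees a single logarithm,
   shifted by a constant; one that avoids neither contains the middle half, and
   is compared with the mean zero. *)
Lemma two_logs_oscillation (c d : R) : (a <= c)%R -> (c < d)%R -> (d <= b)%R ->
  exists m : R, \int[mu]_(x in `]c, d[) ((two_logs x - m) ^+ 2)%:E <= (d - c)%:E.
Proof.
move=> ac cd db.
have mVm (m : R) : measurable_fun setT (fun y => (V y - m) ^+ 2)%R.
  by apply: measurable_funX; apply: measurable_funB => //; exact: measurable_V.
have le_div (u v : R) : (0 <= u -> u < v -> 0 <= u / l /\ u / l < v / l)%R.
  by move=> u0 uv; rewrite divr_ge0 ?ltr_pM2r ?invr_gt0// ltW.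
have [dl|ld] := leP d (b - l)%R.
  exists (1 + V ((d - a) / l))%R.
  rewrite (_ : \int[mu]_(x in _) _ =
    \int[mu]_(x in `]c, d[) ((V ((x - a) / l) - (1 + V ((d - a) / l))) ^+ 2)%:E); last first.
    apply: eq_integral => x; rewrite inE/= in_itv/= => /andP[_ xd].
    by rewrite /two_logs right0 ?subr0//; lra.
  rewrite (integral_affine_itv a c d l0 (mVm _))//; last by move=> y; exact: sqr_ge0.
  have [u0 uv] : (0 <= (c - a) / l /\ (c - a) / l < (d - a) / l)%R by apply: le_div; lra.
  rewrite (_ : (d - c = l * ((d - a) / l - (c - a) / l))%R); last by rewrite mulrBr ![(l * _)%R]mulrC !divfK ?gt_eqF//; lra.
  by rewrite EFinM lee_pmul2l//; exact: V_oscillation.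
have [lc|cl] := leP (a + l)%R c.
  exists (- (1 + V ((b - c) / l)))%R.
  rewrite (_ : \int[mu]_(x in _) _ =
    \int[mu]_(x in `]c, d[) ((V ((b - x) / l) - (1 + V ((b - c) / l))) ^+ 2)%:E); last first.
    apply: eq_integral => x; rewrite inE/= in_itv/= => /andP[cx _].
    by rewrite /two_logs left0 ?sub0r; [congr EFin; lra|lra].
  rewrite (integral_reflect_itv b c d l0 (mVm _))//; last by move=> y; exact: sqr_ge0.
  have [u0 uv] : (0 <= (b - d) / l /\ (b - d) / l < (b - c) / l)%R by apply: le_div; lra.
  rewrite (_ : (d - c = l * ((b - c) / l - (b - d) / l))%R); last by rewrite mulrBr ![(l * _)%R]mulrC !divfK ?gt_eqF//; lra.
  by rewrite EFinM lee_pmul2l//; exact: V_oscillation.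
exists 0%R.
have mV2 : measurable_fun setT (fun y : R => V y ^+ 2)%R.
  by apply: measurable_funX; exact: measurable_V.
have V20 (y : R) : (0 <= V y ^+ 2)%R by exact: sqr_ge0.
rewrite (_ : \int[mu]_(x in _) _ =
  \int[mu]_(x in `]c, d[) ((V ((x - a) / l) ^+ 2)%:E + (V ((b - x) / l) ^+ 2)%:E)); last first.
  apply: eq_integral => x _; rewrite -EFinD /two_logs subr0; congr EFin.
  by have [->|->] := disjoint x; lra.
rewrite ge0_integralD//.
- rewrite (integral_affine_itv a c d l0 mV2 V20) (integral_reflect_itv b c d l0 mV2 V20).
  have unit (u : R) : (0 <= u -> u <= l -> 0 <= u / l <= 1)%R.
    by move=> u0 ul; rewrite divr_ge0 ?(ltW l0)//= ler_pdivrMr// mul1r.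
  have hL := @V_square R ((c - a) / l) ((d - a) / l) (unit _ _ _).
  have hR := @V_square R ((b - d) / l) ((b - c) / l) (unit _ _ _).
  have {}hL := hL ltac:(lra) ltac:(lra); have {}hR := hR ltac:(lra) ltac:(lra).
  have lE0 : 0 <= l%:E by rewrite lee_fin ltW.
  apply: le_trans (leeD (lee_wpmul2l lE0 hL) (lee_wpmul2l lE0 hR)) _.
  (* The total is (2 l - (c - a)) + (2 l - (b - d)), which is d - c because b - a = 4 l. *)
  rewrite -!EFinM -EFinD lee_fin !mulrBr ![(l * (_ / l))%R]mulrC !divfK ?gt_eqF//.
  by move: lE; lra.
- by move=> x _; rewrite lee_fin sqr_ge0.
- by apply/measurable_EFinP/measurable_funTS/measurable_funX.
- by move=> x _; rewrite lee_fin sqr_ge0.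
- by apply/measurable_EFinP/measurable_funTS/measurable_funX.
Qed.

Lemma two_logs_bmo_norm (b0 b1 : bool) :
  bmo_norm [set` Interval (BSide b0 a) (BSide b1 b)] two_logs <= 1.
Proof.
have iI := integrable_two_logs b0 b1; have mphi := measurable_two_logs.
rewrite /bmo_norm -(_ : sqrte 1 = 1 :> \bar R); last by rewrite /= sqrtr1.
rewrite lee_sqrt//; apply: ge_ereal_sup => _ [J [J_itv subJ J0] <-].
have mI : measurable [set` Interval (BSide b0 a) (BSide b1 b)] by exact: measurable_itv.
have mJ : measurable J by rewrite (is_intervalP J).1//; exact: measurable_itv.
have Jfin : mu J < +oo.
  apply: (@le_lt_trans _ _ (mu [set` Interval (BSide b0 a) (BSide b1 b)])).
    by apply: le_measure; rewrite ?inE.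
  by rewrite lebesgue_measure_itv/=; case: ifPn => _; rewrite -?EFinD ltry.
have [c [d [b2 [b3 [cd EJ]]]]] := itv_ends J_itv J0 Jfin; rewrite EJ in subJ *.
have [ac db] := sub_itv_ends cd subJ.
have icd : mu.-integrable `]c, d[ (EFin \o two_logs).
  apply: integrableS iI => //; apply: subset_trans subJ => x /=.
  rewrite in_itv/= itv_boundlr => /andP[cx xd].
  by apply/andP; split; [case: (b2)|case: (b3)]; rewrite bnd_simp// ltW.
have dc : (0 < d - c)%R by rewrite subr_gt0.
have mphi' := @measurable_funTS _ _ _ _ `]c, d[%classic two_logs mphi.
have Ek : \int[mu]_(x in `]c, d[) (two_logs x)%:E =
    (fine (average [set` Interval (BSide b2 c) (BSide b3 d)] two_logs) * (d - c))%:E.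
  rewrite average_itv// -(@fineK _ (\int[mu]_(x in `]c, d[) _)); last exact: integrable_fin_num.
  by rewrite -EFinM/= mulrAC mulVf ?mul1r// gt_eqF.
rewrite average_itv//; last first.
  by apply/measurable_funTS/measurable_funX/measurableT_comp => //; exact: measurable_funB.
under eq_integral do rewrite real_normK ?num_real//.
rewrite lee_pdivrMl// mule1.
have [m Hm] := two_logs_oscillation ac cd db.
exact: variance_minimal Hm.
Qed.

End two_logs.

(** All moments of [two_logs] of order at least 1 are the same multiple D of those of the
    exponential distribution; D cancels between the two norms, and the factor from the BMO norm is
    at most 1. *)
Lemma constant_optimal (a b : R) (b0 b1 : bool) (p r C : R) :
  (a < b)%R -> (1 <= p)%R -> (Num.max 2 p <= r)%R ->
  let I := [set` Interval (BSide b0 a) (BSide b1 b)] in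
  (forall phi : R -> R, bmo I phi -> average I phi = 0 ->
    Lp_norm I r phi <= C%:E * Lp_norm I p phi `^ (p / r) * bmo_norm I phi `^ (1 - p / r)) ->
  ((eg r / eg p) `^ r^-1 <= C)%R.
Proof.
move=> ab p1 r2 I HC; pose l : R := ((b - a) / 4)%R.
have l0 : (0 < l)%R by rewrite divr_gt0// subr_gt0.
have lE : (b - a = 4 * l)%R by rewrite /l; lra.
move: l l0 lE => l l0 lE.
have [r2' pr] : (2 <= r)%R /\ (p <= r)%R by move: r2; rewrite ge_max => /andP[].
have [p0 r0] : (0 < p)%R /\ (0 < r)%R by lra.
have mphi := @measurable_funTS _ _ _ _ `]a, b[%classic _ (measurable_two_logs a b l).
have N1 := two_logs_bmo_norm l0 lE b0 b1; rewrite -/I in N1.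
have avg0 : average I (two_logs a b l) = 0 by rewrite average_itv// (integral_two_logs l0 lE) mule0.
have phi_bmo : bmo I (two_logs a b l).
  by split; [exact: (integrable_two_logs l0 lE)|exact: le_lt_trans N1 (ltry _)].
have := HC _ phi_bmo avg0.
have Nfin : bmo_norm I (two_logs a b l) \is a fin_num by rewrite ge0_fin_numE ?sqrte_ge0//; exact: phi_bmo.2.
have n0 : (0 <= fine (bmo_norm I (two_logs a b l)))%R by exact/fine_ge0/sqrte_ge0.
move: N1; rewrite -(fineK Nfin) lee_fin => n1.
have [D D0 HD] := two_logs_moments l0 lE.
have [ep er] := (eg_gt0 p0, eg_gt0 r0).
have r1 : (1 <= r)%R by lra.
rewrite !Lp_norm_itv// !HD// !poweR_EFin -powRrM -!EFinM lee_fin.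
have -> : (p^-1 * (p / r) = r^-1)%R by rewrite mulrA mulVf ?mul1r// gt_eqF.
have -> : (D * eg r = eg r / eg p * (D * eg p))%R by rewrite mulrCA divfK// gt_eqF.
have K_ge0 : (0 <= eg r / eg p)%R by rewrite divr_ge0// ltW.
have D_ge0 : (0 <= D * eg p)%R by rewrite mulr_ge0// ltW.
rewrite (powRM _ K_ge0 D_ge0).
set K := (_ `^ r^-1)%R; set Y := (_ `^ r^-1)%R; set q := (_ `^ (1 - p / r))%R => H.
have K0 : (0 < K)%R by rewrite powR_gt0// divr_gt0.
have Y0 : (0 < Y)%R by rewrite powR_gt0// mulr_gt0.
have q0 : (0 <= q)%R by exact: powR_ge0.
have q1 : (q <= 1)%R.
  apply: (@le_trans _ _ (1 `^ (1 - p / r))%R); last by rewrite powR1.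
  apply: ge0_ler_powR; rewrite ?nnegrE//.
  by rewrite subr_ge0 ler_pdivrMr// mul1r.
have {}H : (K <= C * q)%R by rewrite -(ler_pM2r Y0) mulrAC.
(* C is an arbitrary real; its sign must be known before q <= 1 yields C * q <= C. *)
have C0 : (0 < C)%R.
  rewrite ltNge; apply/negP => C0; have : (C * q <= 0)%R by rewrite mulr_le0_ge0.
  by move=> h; move: (lt_le_trans K0 (le_trans H h)); rewrite ltxx.
by apply: le_trans H _; rewrite ler_piMr// ltW.
Qed.

End extremal.

Theorem theorem1p1 (R : realType) (I : set R) (p r : R)
    (I_itv : is_interval I) (I_bnd : bounded_set I)
    (I_pos : (0 < lebesgue_measure I)%E)
    (p_ge1 : 1 <= p) (r_ge : Num.max 2 p <= r) :
  (forall phi : R -> R, bmo I phi -> average I phi = 0%E ->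
     (Lp_norm I r phi <=
        ((Gamma (r + 1) / Gamma (p + 1)) `^ r^-1)%:E
        * Lp_norm I p phi `^ (p / r) * bmo_norm I phi `^ (1 - p / r))%E) /\
  (forall C : R,
     (forall phi : R -> R, bmo I phi -> average I phi = 0%E ->
        (Lp_norm I r phi <=
           C%:E * Lp_norm I p phi `^ (p / r) * bmo_norm I phi `^ (1 - p / r))%E) ->
     (Gamma (r + 1) / Gamma (p + 1)) `^ r^-1 <= C).
Proof.
have [p0 r0] : 0 < p /\ 0 < r by move: r_ge; rewrite ge_max => /andP[? ?]; split; lra.
rewrite !Gamma_eg//.
have [a [b [b0 [b1 [ab ->]]]]] := itv_ends I_itv I_pos (bounded_lty I_itv I_bnd).
by split => [phi|C]; [exact: multiplicative_inequality|exact: constant_optimal].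
Qed.
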